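(* Let $\{\mathcal{T}_h\}$ be a shape-regular family of cubical meshes of a bounded domain $\Omega\subset\mathbb{R}^n$ and let $1\le k\le n$. Let $V_h^{k-1}=\mathcal{S}_1^+\Lambda^{k-1}(\mathcal{T}_h)$, $V_h^k=\mathcal{Q}_1^-\Lambda^k(\mathcal{T}_h)$, $\tilde V_h^{k-1}=\mathcal{Q}_1^-\Lambda^{k-1}(\mathcal{T}_h)$, let $W_h^{k-1}$ be the space of $(k-1)$-forms on $\Omega$ that are constant on each $T\in\mathcal{T}_h$, and let $$\langle u,v\rangle_h=\sum_{T\in\mathcal{T}_h}2^{-n}|T|\sum_{x\in\Delta_0(T)}\langle u_x,v_x\rangle_{\mathrm{Alt}},$$ where in the term for $T$ the values $u_x,v_x$ are those of $u|_T,v|_T$ at the vertex $x$. Let $\Pi_h:\mathcal{S}_1^+\Lambda^{k-1}(\mathcal{T}_h)\to\mathcal{Q}_1^-\Lambda^{k-1}(\mathcal{T}_h)$ be defined by $\int_f\mathrm{tr}_f\,\Pi_hu=\int_f\mathrm{tr}_f\,u$ for all $f\in\Delta_{k-1}(\mathcal{T}_h)$. Then: (A) $\langle\cdot,\cdot\rangle_h$ is an inner product on $V_h^{k-1}$ whose norm is equivalent to the $L^2$ norm $\|\cdot\|$ on $V_h^{k-1}$, with constants independent of $h$. (B) $\langle\tau,\tau_0\rangle=\langle\tau,\tau_0\rangle_h$ for all $\tau\in\tilde V_h^{k-1}$, $\tau_0\in W_h^{k-1}$; and for all $\tau\in V_h^{k-1}$, $d\Pi_h\tau=d\tau$, $\|\Pi_h\tau\|\le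 C\|\tau\|$ with $C$ independent of $h$, and $\langle\Pi_h\tau,\tau_0\rangle_h=\langle\tau,\tau_0\rangle_h$ for all $\tau_0\in W_h^{k-1}$. (Locality) The operator $d_h^*:\mathcal{Q}_1^-\Lambda^k(\mathcal{T}_h)\to\mathcal{S}_1^+\Lambda^{k-1}(\mathcal{T}_h)$ defined by $\langle d_h^*u,\tau\rangle_h=\langle u,d\tau\rangle$ for all $\tau\in\mathcal{S}_1^+\Lambda^{k-1}(\mathcal{T}_h)$ is local: for any vertex $x$ of $\mathcal{T}_h$, the values at $x$ of $(d_h^*u)|_T$, for all $T\in\mathcal{T}_h$ having $x$ as a vertex, depend only on the restriction of $u$ to the union of the elements $T\in\mathcal{T}_h$ having $x$ as a vertex.
   Context: A cubical mesh is a (face-to-face) mesh whose elements $T$ are Cartesian products $I_1\times\dots\times I_n$ of compact nondegenerate intervals; $\Delta_j(T)$ is the set of $j$-dimensional faces of $T$ (so $\Delta_0(T)$ are its vertices), $\Delta_j(\mathcal{T}_h)$ the set of all $j$-dimensional faces of elements of $\mathcal{T}_h$, and $|T|$ the volume. $\langle u,v\rangle=\int_\Omega\langle u_x,v_x\rangle_{\mathrm{Alt}}\,dx$ is the $L^2$ inner product of forms, where $\langle\cdot,\cdot\rangle_{\mathrm{Alt}}$ is the inner product on alternating $j$-forms for which the $dx_\sigma$ below are orthonormal. Notation: $\Sigma(j)$ is the set of increasing sequences $\sigma=(\sigma_1<\dots<\sigma_j)$ in $\{1,\dots,n\}$; $\llbracket\sigma\rrbracket=\{\sigma_1,\dots,\sigma_j\}$;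 $\sigma^*\in\Sigma(n-j)$ is the complementary sequence; $dx_\sigma=dx_{\sigma_1}\wedge\dots\wedge dx_{\sigma_j}$. $\mathcal{Q}_1$ denotes polynomials of degree at most $1$ in each variable separately. $\mathcal{Q}_1^-\Lambda^j$ is the space of forms $\sum_{\sigma\in\Sigma(j)}u_\sigma dx_\sigma$ with $u_\sigma\in\mathcal{Q}_1$ depending only on the variables $x_i$, $i\in\llbracket\sigma^*\rrbracket$. $\mathcal{B}\Lambda^j$ is the span of the forms $p_{\sigma^*}p_\sigma dx_\sigma$, $\sigma\in\Sigma(j)$, where $p_\sigma$ and $p_{\sigma^*}$ are $\mathcal{Q}_1$ polynomials in the variables $\{x_i\}_{i\in\llbracket\sigma\rrbracket}$ and $\{x_i\}_{i\in\llbracket\sigma^*\rrbracket}$ respectively, and $p_\sigma(0)=0$. The Koszul operator is $(\kappa u)_x=u_x\lrcorner x$ (contraction with the position vector), $d$ is the exterior derivative, and $\mathcal{S}_1^+\Lambda^j=\mathcal{Q}_1^-\Lambda^j+d\kappa\mathcal{B}\Lambda^j$. A suffix $(T)$ denotes restriction to $T$; $\mathrm{tr}_f$ is the trace (pullback) to a face $f$. Global spaces: $\mathcal{Q}_1^-\Lambda^j(\mathcal{T}_h)$ consists of piecewise forms with $u|_T\in\mathcal{Q}_1^-\Lambda^j(T)$ and with the degrees of freedom $\int_f\mathrm{tr}_fu$, $f\in\Delta_j(\mathcal{T}_h)$, single-valued (the same from every element containing $f$). $\mathcal{S}_1^+\Lambda^j(\mathcal{T}_h)$ consists of piecewise forms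 with $u|_T\in\mathcal{S}_1^+\Lambda^j(T)$ and with the degrees of freedom $\int_f\mathrm{tr}_fu\wedge v$, $v\in\mathcal{Q}_1\Lambda^0(f)$, $f\in\Delta_j(\mathcal{T}_h)$, single-valued. Both are subspaces of $H\Lambda^j(\Omega)=\{u\in L^2\Lambda^j(\Omega):du\in L^2\Lambda^{j+1}(\Omega)\}$. *)

(* Defs.v *)
(* Written over MathComp-Analysis and multinomials.  The notations of [mpoly]
   clash with those of MathComp-Analysis, so that file is imported without
   them: [mpoly n R] is the ring of polynomials in [n] variables, [mderiv i] the
   partial derivative in the [i]-th variable, [meval x] evaluation at [x],
   [mpolyX R (mnm1 i)] the [i]-th variable and [mpolyC n c] a constant. *)
From HB Require Import structures.
From mathcomp Require Import all_boot all_order all_algebra finmap.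
From mathcomp Require Import all_classical all_reals all_analysis.
From mathcomp Require mpoly.
Import -(notations) mpoly.

Set Implicit Arguments.
Unset Strict Implicit.
Unset Printing Implicit Defensive.
Import Order.TTheory GRing.Theory Num.Theory.
Import numFieldNormedType.Exports.
Local Open Scope classical_set_scope.
Local Open Scope ring_scope.

Section Algebra.
Context (R : realType).

Definition linear_span (V : lmodType R) (G : set V) : set V :=
  [set u | exists m (c : 'I_m -> R) (g : 'I_m -> V),
     (forall i, G (g i)) /\ u = \sum_i c i *: g i].

Definition inner_product_on (V : lmodType R) (S : set V) (b : V -> V -> R) :=
  [/\ forall u v, S u -> S v -> b u v = b v u,
      forall (a : R) u v w, S u -> S v -> S w ->
        b (a *: u + v) w = a * b u w + b v w
    & forall u, S u -> u <> 0 -> 0 < b u u].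

End Algebra.

Section Forms.
Context (R : realType) (n : nat).

(* Polynomial differential forms on R^n (of mixed degree): the increasing
   sequence sigma is represented by its underlying set, and [u] stands for the
   sum over sigma of [u sigma] dx_sigma. *)
Definition form := {ffun {set 'I_n} -> mpoly n R}.

Definition peval (p : mpoly n R) (x : 'rV[R]_n) : R := meval (x 0) p.

Definition is_form (j : nat) (u : form) :=
  forall sigma : {set 'I_n}, #|sigma| <> j -> u sigma = 0.

Definition dx (sigma : {set 'I_n}) (p : mpoly n R) : form :=
  [ffun tau => if tau == sigma then p else 0].

(* If i is in tau, then dx_i /\ dx_(tau - i) = wsign tau i dx_tau; for i not in
   tau, wsign tau i dx_tau is the contraction of dx_(tau + i) with the i-th
   basis vector in its first slot. *)
Definition wsign (tau : {set 'I_n}) (i : 'I_n) : R :=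
  (-1) ^+ #|[set l in tau | (l < i)%N]%SET|.

Definition dext (u : form) : form :=
  [ffun tau : {set 'I_n} =>
     \sum_(i in tau) wsign tau i *: mderiv i (u (tau :\ i)%SET)].

Definition koszul (u : form) : form :=
  [ffun tau : {set 'I_n} =>
     \sum_(i | i \notin tau)
        wsign tau i *: (mpolyX R (mnm1 i) * u (i |: tau)%SET)].

Definition alt_inner (u v : form) (x : 'rV[R]_n) : R :=
  \sum_(sigma : {set 'I_n}) peval (u sigma) x * peval (v sigma) x.

Definition wedge0 (u : form) (v : mpoly n R) : form :=
  [ffun sigma => u sigma * v].

(* Q_1 polynomials in the variables x_i with i in S. *)
Definition Q1 (S : {set 'I_n}) (p : mpoly n R) :=
  forall m : multinom n, m \in msupp p -> forall i, (m i <= (i \in S))%N.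

Definition Q1m (j : nat) : set form :=
  [set u | is_form j u /\
     forall sigma : {set 'I_n}, #|sigma| = j -> Q1 (~: sigma)%SET (u sigma)].

Definition Bgen (j : nat) : set form :=
  [set u | exists (sigma : {set 'I_n}) (p q : mpoly n R),
     [/\ #|sigma| = j, Q1 sigma p, Q1 (~: sigma)%SET q, peval p 0 = 0
       & u = dx sigma (q * p)]].

Definition Bspace (j : nat) : set form := linear_span (Bgen j).

Definition S1p (j : nat) : set form :=
  [set u | exists q b, [/\ Q1m j q, Bspace j b & u = q + dext (koszul b)]].

(* Boxes: the pair (a, b) stands for the product of the intervals [a_i, b_i],
   some of which may be points, so that the faces of a box are boxes. *)
Definition box := ('rV[R]_n * 'rV[R]_n)%type.

Definition box_set (T : box) : set 'rV[R]_n :=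
  [set x | forall i, T.1 0 i <= x 0 i <= T.2 0 i].

Definition nondegenerate (T : box) := forall i, T.1 0 i < T.2 0 i.

(* The vertices of T are indexed by the subsets A of {1, ..., n}, without
   repetition when T is nondegenerate. *)
Definition vertex (T : box) (A : {set 'I_n}) : 'rV[R]_n :=
  \row_i (if i \in A then T.2 0 i else T.1 0 i).

Definition is_vertex (T : box) (x : 'rV[R]_n) := exists A, x = vertex T A.

(* The face of T through the vertex A with tangential directions sigma. *)
Definition face (T : box) (sigma A : {set 'I_n}) : box :=
  (\row_i (if i \in sigma then T.1 0 i else vertex T A 0 i),
   \row_i (if i \in sigma then T.2 0 i else vertex T A 0 i)).

Definition is_face (j : nat) (T f : box) :=
  exists sigma A : {set 'I_n}, #|sigma| = j /\ f = face T sigma A.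

Definition dirs (f : box) : {set 'I_n} := [set i | f.1 0 i < f.2 0 i]%SET.

Definition volume (T : box) : R := \prod_i (T.2 0 i - T.1 0 i).

(* Integral of F over f with respect to the Lebesgue measure of dimension
   #|dirs f|, as an iterated integral over the directions in which f is not
   reduced to a point. *)
Fixpoint iter_int (f : box) (s : seq 'I_n) (F : 'rV[R]_n -> R)
    (x : 'rV[R]_n) : R :=
  if s is i :: s' then
    \int[lebesgue_measure]_(t in `[f.1 0 i, f.2 0 i])
       iter_int f s' F (\row_l (if l == i then t else x 0 l))
  else F x.

Definition box_int (f : box) (F : 'rV[R]_n -> R) : R :=
  iter_int f (enum (dirs f)) F f.1.

(* Pullback to f of dx_sigma is zero unless the directions in sigma are all
   tangential to f; coefficients are restricted to f only when evaluated. *)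
Definition tr (f : box) (u : form) : form :=
  [ffun sigma : {set 'I_n} => if sigma \subset dirs f then u sigma else 0].

(* Integral over f of a form whose degree is the dimension of f. *)
Definition face_int (f : box) (u : form) : R :=
  box_int f (peval (u (dirs f))).

End Forms.

Section Meshes.
Context (R : realType) (n : nat).

Definition enorm (x : 'rV[R]_n) : R := Num.sqrt (\sum_i x 0 i ^+ 2).

Definition bounded_domain (Omega : set 'rV[R]_n) :=
  [/\ Omega !=set0, open Omega, connected Omega & bounded_set Omega].

Definition cubical_mesh (Omega : set 'rV[R]_n) (Th : {fset box R n}) :=
  [/\ forall T : Th, nondegenerate (val T),
      closure Omega = \bigcup_(T : Th) box_set (val T)
    & forall T T' : Th, T <> T' ->
        box_set (val T) `&` box_set (val T') = set0 \/
        exists j f, [/\ is_face j (val T) f, is_face j (val T') f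
          & box_set f = box_set (val T) `&` box_set (val T')]].

(* The diameter of T is at most gamma times the radius of a ball inside T. *)
Definition shape_regular (H : Type) (Th : H -> {fset box R n}) :=
  exists gamma : R, forall h (T : Th h), exists (c : 'rV[R]_n) (r : R),
    [/\ 0 < r,
        forall x, enorm (x - c) <= r -> box_set (val T) x
      & forall x y, box_set (val T) x -> box_set (val T) y ->
          enorm (x - y) <= gamma * r].

(* Piecewise polynomial forms.  As the elements have nonempty interior, a
   polynomial form on T is the same as a polynomial form on R^n. *)
Definition pform (Th : {fset box R n}) := {ffun Th -> form R n}.

Variable Th : {fset box R n}.
Implicit Types u v w : pform Th.

Definition Q1m_mesh (j : nat) : set (pform Th) :=
  [set u | (forall T : Th, Q1m j (u T)) /\
     forall (T T' : Th) (f : box R n),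
       is_face j (val T) f -> is_face j (val T') f ->
       face_int f (tr f (u T)) = face_int f (tr f (u T'))].

Definition S1p_mesh (j : nat) : set (pform Th) :=
  [set u | (forall T : Th, S1p j (u T)) /\
     forall (T T' : Th) (f : box R n) (v : mpoly n R),
       is_face j (val T) f -> is_face j (val T') f -> Q1 (dirs f) v ->
       face_int f (wedge0 (tr f (u T)) v) =
       face_int f (wedge0 (tr f (u T')) v)].

Definition const_mesh (j : nat) : set (pform Th) :=
  [set u | forall T : Th, is_form j (u T) /\
     forall sigma, exists c : R, u T sigma = mpolyC n c].

Definition dmesh u : pform Th := [ffun T => dext (u T)].

Definition l2_inner u v : R :=
  \sum_(T : Th) box_int (val T) (alt_inner (u T) (v T)).

Definition l2_norm u : R := Num.sqrt (l2_inner u u).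

Definition h_inner u v : R :=
  \sum_(T : Th) 2 ^- n * volume (val T) *
    \sum_(A : {set 'I_n}) alt_inner (u T) (v T) (vertex (val T) A).

Definition h_norm u : R := Num.sqrt (h_inner u u).

(* [w] is the interpolant Pi_h u. *)
Definition is_interpolant (j : nat) u w :=
  Q1m_mesh j w /\
  forall (T : Th) (f : box R n), is_face j (val T) f ->
    face_int f (tr f (w T)) = face_int f (tr f (u T)).

(* [w], a j-form, is d_h^* u for a (j+1)-form u. *)
Definition is_coderivative (j : nat) u w :=
  S1p_mesh j w /\
  forall tau, S1p_mesh j tau -> h_inner w tau = l2_inner u (dmesh tau).

End Meshes.

Arguments Q1m_mesh {R n} Th j.
Arguments S1p_mesh {R n} Th j.
Arguments const_mesh {R n} Th j.
Arguments l2_inner {R n Th}.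
Arguments h_inner {R n Th}.

(* Main.v *)
Require Import Defs.
From HB Require Import structures.
From mathcomp Require Import all_boot all_order all_algebra finmap.
From mathcomp Require Import all_classical all_reals all_analysis.
From mathcomp Require Import ring lra zify.
From mathcomp Require mpoly.
Import -(notations) mpoly.

Set Implicit Arguments.
Unset Strict Implicit.
Unset Printing Implicit Defensive.
Import Order.TTheory GRing.Theory Num.Theory.
Import numFieldNormedType.Exports.
Local Open Scope classical_set_scope.
Local Open Scope ring_scope.

(* On a box T a form u in S_1^+ Lambda^j is determined by the values u_sigma(x)
   at the vertices x of T, and its trace on a j-face f is a Q_1 polynomial times
   the volume form, determined by the values of u_sigma, sigma = dirs f, at the
   vertices of f.  So a vertex of a j-face is a global degree of freedom, the
   form <.,.>_h is diagonal in the nodal basis, and the coderivative is local.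

   Unisolvence.  Modulo Q_1^- Lambda^j, the space S_1^+ Lambda^j = Q_1^- + d kappa B
   does not depend on the origin chosen for kappa: by Cartan's formula the exact
   forms d e, e multilinear, are of the form d kappa E.  In coordinates mapping T
   to the unit cube, evaluating sum a(sigma, A) d kappa (y^A dy_sigma) at the
   vertices is triangular in m = |A cap sigma|, with diagonal blocks
   2 m + kappa^T kappa, positive definite for m > 0; at m = 0 the forms of Q_1^-
   are used instead.  The matrix does not depend on T, which makes the constants
   depend on the shape only.

   The interpolant Pi_h u has at a vertex x of a j-face f the average of u_sigma
   over the vertices of f.  As u_sigma has degree at most 2 in each variable, the
   trapezoidal rule is exact on its derivatives, so that d commutes with Pi_h. *)

(** * Partial degrees and restriction to lines parallel to an axis *)

Section Degree.
Context (R : realType) (n : nat).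
Implicit Types (p q : mpoly n R) (i l : 'I_n) (x : 'rV[R]_n) (s t u : R).

(** The obstacle is that u_sigma may be quadratic in x_i for i outside sigma: the vertex rule is not
    exact on products, and it is not obvious that vertex values determine u. At a corner of the unit
    cube y_i^2 = y_i, so different monomials collapse. What saves the triangular structure is that
    exchanging a direction of sigma with one of A leaves A cap sigma unchanged, while a collapsed
    square always comes from a level one higher.

    The condition p_sigma(0) = 0 ties B to the origin. Dropping it only adds the forms y^A dy_sigma
    with A disjoint from sigma; these lie in Q_1^-, which d kappa maps to itself, so the origin can
    be moved to a corner of T.

    In (A), the bound of the discrete norm by the L^2 norm tensorizes a one-dimensional inequality
    with factor 1/9 per direction. The converse combines the inverse of the evaluation matrix with
    the scaling of j-forms, and there the shape enters. The L^2 stability of Pi_h is obtained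
    indirectly: for the discrete norm Pi_h averages over vertices of faces, hence is a contraction,
    and (A) transfers this to L^2. *)

Definition dle i (d : nat) p := forall m, m \in msupp p -> (m i <= d)%N.

Lemma dleW i d d' p : (d <= d')%N -> dle i d p -> dle i d' p.
Proof. by move=> dd' ip m /ip /leq_trans; apply. Qed.

Lemma dle0 i d : dle i d 0.
Proof. by move=> m; rewrite msupp0. Qed.

Lemma dleD i d p q : dle i d p -> dle i d q -> dle i d (p + q).
Proof.
by move=> ip iq m /msuppD_le; rewrite mem_cat => /orP[/ip|/iq].
Qed.

Lemma dleZ i d a p : dle i d p -> dle i d (a *: p).
Proof. by move=> ip m /msuppZ_le /ip. Qed.

Lemma dleB i d p q : dle i d p -> dle i d q -> dle i d (p - q).
Proof. by move=> ip iq; rewrite -scaleN1r; apply: dleD => //; apply: dleZ. Qed.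

Lemma dle_sum I (r : seq I) (P : pred I) (F : I -> mpoly n R) i d :
  (forall k, P k -> dle i d (F k)) -> dle i d (\sum_(k <- r | P k) F k).
Proof.
by move=> iF; elim/big_ind : _ => // [|p q]; [exact: dle0|exact: dleD].
Qed.

Lemma dleM i d d' p q : dle i d p -> dle i d' q -> dle i (d + d') (p * q).
Proof.
move=> ip iq m /msuppM_le /allpairsP[[m1 m2] [/= /ip h1 /iq h2 ->]].
by rewrite mnmDE leq_add.
Qed.

Lemma dleC i a : dle i 0 (mpolyC n a).
Proof.
by move=> m; rewrite msuppC; case: eqP => // _; rewrite inE => /eqP ->; rewrite mnm0E.
Qed.

Lemma dleXU i l : dle i (i == l) (mpolyX R (mnm1 l)).
Proof. by move=> m; rewrite msuppX inE => /eqP ->; rewrite mnm1E eq_sym. Qed.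

Lemma dle_mderiv i l d p : dle i d p -> dle i d (mderiv l p).
Proof.
move=> ip m; rewrite mcoeff_msupp mcoeff_deriv mulrn_eq0 /= -mcoeff_msupp.
by move=> /ip; apply: leq_trans; rewrite mnmDE leq_addr.
Qed.

Lemma dle_mderivS i d p : dle i d.+1 p -> dle i d (mderiv i p).
Proof.
move=> ip m; rewrite mcoeff_msupp mcoeff_deriv mulrn_eq0 /= -mcoeff_msupp.
by move=> /ip; rewrite mnmDE mnm1E eqxx addn1.
Qed.

Lemma Q1P (S : {set 'I_n}) p : Q1 S p <-> forall i, dle i (i \in S) p.
Proof. by split=> [h i m /h|h m mp i]; [exact|exact: h]. Qed.

Lemma Q1W (S S' : {set 'I_n}) p : S \subset S' -> Q1 S p -> Q1 S' p.
Proof.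
move=> SS' /Q1P h; apply/Q1P => i; apply: dleW (h i).
by case: (boolP (i \in S)) => // /(fintype.subsetP SS') ->.
Qed.

Lemma Q1M (S S' : {set 'I_n}) p q : [disjoint S & S']%B -> Q1 S p -> Q1 S' q ->
  Q1 (S :|: S') (p * q).
Proof.
move=> dSS' /Q1P hp /Q1P hq; apply/Q1P => i.
apply: dleW (dleM (hp i) (hq i)); rewrite inE.
case: (boolP (i \in S)) => [/(disjointFr dSS') ->|] //=.
Qed.

(** Slicing, evaluation and differentiation behave well under sums and under multiplication by a
    variable, so identities between them are checked along this induction. *)
Lemma mpoly_ringind (P : mpoly n R -> Prop) :
  (forall c, P (mpolyC n c)) -> (forall p q, P p -> P q -> P (p + q)) ->
  (forall i p, P p -> P (mpolyX R (mnm1 i) * p)) -> forall p, P p.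
Proof.
move=> PC PD PX; suff PM : forall m c, P (mpolyC n c * mpolyX R m).
  move=> p; rewrite (mpolyE p); elim/big_ind : _ => //; first by rewrite -mpolyC0.
  by move=> m _; rewrite -mul_mpolyC.
move=> m c; have [k] := ubnP (mdeg m); elim: k m => // k IH m.
have [->|m0 mk] := eqVneq m (@mnm0 n); first by rewrite mpolyX0 mulr1.
have [i mi] : exists i, m i != 0%N.
  apply/existsP; apply: contra_neqT m0; rewrite negb_exists => /forallP h.
  by apply/mnmP => i; rewrite mnm0E; move: (h i) => /negbNE/eqP.
have im : m = mnm_add (mnm_sub m (mnm1 i)) (mnm1 i).
  apply/mnmP => l; rewrite mnmDE mnmBE mnm1E subnK //.
  by case: eqP => // <-; rewrite lt0n.
rewrite im mpolyXD [X in _ * X]mulrC mulrCA; apply: (PX i); apply: IH.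
by move: mk; rewrite {1}im mdegD mdeg1 addn1 ltnS.
Qed.

Definition upd x i (t : R) : 'rV[R]_n := \row_l (if l == i then t else x 0 l).

Lemma updE x i t l : upd x i t 0 l = if l == i then t else x 0 l.
Proof. by rewrite mxE. Qed.

Lemma upd_id x i : upd x i (x 0 i) = x.
Proof. by apply/rowP => l; rewrite mxE; case: eqP => // ->. Qed.

(* The restriction of [p] to the line through [x] in direction [i]. *)
Definition slice i x p : {poly R} :=
  mmap (@polyC R) (fun l => if l == i then 'X else (x 0 l)%:P) p.

Lemma sliceD i x p q : slice i x (p + q) = slice i x p + slice i x q.
Proof. exact: mmapD. Qed.
Lemma sliceM i x p q : slice i x (p * q) = slice i x p * slice i x q.
Proof. exact: rmorphM. Qed.
Lemma sliceC i x c : slice i x (mpolyC n c) = c%:P.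
Proof. exact: mmapC. Qed.
Lemma sliceXU i x l :
  slice i x (mpolyX R (mnm1 l)) = if l == i then 'X else (x 0 l)%:P.
Proof. by rewrite /slice mmapX mmap1U. Qed.

Lemma pevalD p q x : peval (p + q) x = peval p x + peval q x.
Proof. exact: mevalD. Qed.
Lemma pevalB p q x : peval (p - q) x = peval p x - peval q x.
Proof. exact: mevalB. Qed.
Lemma pevalM p q x : peval (p * q) x = peval p x * peval q x.
Proof. exact: mevalM. Qed.
Lemma pevalZ a q x : peval (a *: q) x = a * peval q x.
Proof. exact: mevalZ. Qed.
Lemma pevalC a x : peval (mpolyC n a) x = a.
Proof. exact: mevalC. Qed.
Lemma peval0 x : peval 0 x = 0.
Proof. exact: meval0. Qed.
Lemma peval1 x : peval 1 x = 1.
Proof. exact: meval1. Qed.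
Lemma pevalXU i x : peval (mpolyX R (mnm1 i)) x = x 0 i.
Proof. exact: mevalXU. Qed.
Lemma peval_sum I (r : seq I) (P : pred I) (F : I -> mpoly n R) x :
  peval (\sum_(k <- r | P k) F k) x = \sum_(k <- r | P k) peval (F k) x.
Proof. exact: (big_morph (fun p => peval p x) (fun p q => pevalD p q x) (peval0 x)). Qed.
Lemma peval_prod I (r : seq I) (P : pred I) (F : I -> mpoly n R) x :
  peval (\prod_(k <- r | P k) F k) x = \prod_(k <- r | P k) peval (F k) x.
Proof. exact: (big_morph (fun p => peval p x) (fun p q => pevalM p q x) (peval1 x)). Qed.

Lemma horner_slice i x p t : (slice i x p).[t] = peval p (upd x i t).
Proof.
elim/mpoly_ringind : p => [c|p q IHp IHq|l p IHp].
- by rewrite sliceC pevalC hornerC.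
- by rewrite sliceD pevalD hornerD IHp IHq.
- rewrite sliceM pevalM hornerM IHp sliceXU pevalXU updE.
  by case: eqP => _; rewrite ?hornerX ?hornerC.
Qed.

Lemma slice_mderiv i x p : slice i x (mderiv i p) = (slice i x p)^`().
Proof.
elim/mpoly_ringind : p => [c|p q IHp IHq|l p IHp].
- by rewrite mderivC sliceC derivC -mpolyC0 sliceC.
- by rewrite mderivD !sliceD IHp IHq derivD.
- rewrite mderivM sliceD !sliceM IHp derivM sliceXU; congr (_ * _ + _).
  rewrite mderivX mnm1E; case: eqP => [->|_]; last first.
    by rewrite scale0r -mpolyC0 sliceC derivC.
  have -> : mnm_sub (mnm1 i) (mnm1 i) = @mnm0 n by apply/mnmP => k; rewrite mnmBE subnn mnm0E.
  by rewrite mpolyX0 scale1r derivX -mpolyC1 sliceC.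
Qed.

Lemma size_slice i x p d : dle i d p -> (size (slice i x p) <= d.+1)%N.
Proof.
move=> ip; apply/leq_sizeP => k dk; rewrite /slice /mmap coef_sum.
rewrite big1_seq // => m /= mp; rewrite coefCM /mmap1 (bigD1 i)//= eqxx.
rewrite (eq_bigr (fun l => (x 0 l ^+ m l)%:P)) => [|l /negbTE ->]; last first.
  by rewrite polyC_exp.
rewrite -rmorph_prod /= coefMC coefXn.
have := ip m mp => mid.
by rewrite (gtn_eqF (leq_ltn_trans mid dk)) mul0r mulr0.
Qed.

Lemma peval_deg1 i p x s t u : dle i 1 p -> s != t ->
  peval p (upd x i u) = ((t - u) * peval p (upd x i s) + (u - s) * peval p (upd x i t)) / (t - s).
Proof.
move=> /(size_slice x); rewrite -!horner_slice => h st.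
rewrite !(horner_coef_wide _ h) !big_ord_recl !big_ord0 /= !expr0 !expr1.
rewrite /bump /= ; set a := (_`_0); set b := (_`_ _); by field; rewrite subr_eq0 eq_sym.
Qed.

Lemma peval_deg1_mderiv i p x y s t : dle i 1 p ->
  (t - s) * peval (mderiv i p) (upd x i y) = peval p (upd x i t) - peval p (upd x i s).
Proof.
move=> /(size_slice x); rewrite -!horner_slice slice_mderiv => h.
rewrite !(horner_coef_wide _ h) !big_ord_recl !big_ord0 /= !expr0 !expr1.
have h' : (size (slice i x p)^`() <= 1)%N.
  by have [->|/lt_size_deriv] := eqVneq (slice i x p) 0; [rewrite deriv0 size_poly0|lia].
rewrite (horner_coef_wide _ h') big_ord_recl !big_ord0 /= expr0 coef_deriv.
by ring.
Qed.

Lemma peval_deg2_trapezoid i p x s t : dle i 2 p ->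
  (t - s) * (peval (mderiv i p) (upd x i s) + peval (mderiv i p) (upd x i t)) / 2
  = peval p (upd x i t) - peval p (upd x i s).
Proof.
move=> /(size_slice x); rewrite -!horner_slice slice_mderiv => h.
rewrite !(horner_coef_wide _ h) !big_ord_recl !big_ord0 /= !expr0 !expr1.
have h' : (size (slice i x p)^`() <= 2)%N.
  by have [->|/lt_size_deriv] := eqVneq (slice i x p) 0; [rewrite deriv0 size_poly0|lia].
rewrite !(horner_coef_wide _ h') !big_ord_recl !big_ord0 /= !expr0 !expr1 !coef_deriv.
by rewrite /bump /=; field.
Qed.

End Degree.

(** * Integrals of polynomials in one variable *)

Section PolynomialIntegral.
Context (R : realType).
Implicit Types (P q r : {poly R}) (a b e : R).
Local Notation mu := (@lebesgue_measure R).

Lemma within_continuous_poly (A : set R) (F : R -> R) q :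
  (forall t, F t = q.[t]) -> {within A, continuous F}.
Proof.
move=> /funext ->; apply: continuous_subspaceT => x; exact: continuous_horner.
Qed.

Lemma integrable_poly a b (F : R -> R) q :
  (forall t, F t = q.[t]) -> mu.-integrable `[a, b] (EFin \o F).
Proof.
move=> Fq; apply: continuous_compact_integrable; first exact: segment_compact.
exact: within_continuous_poly Fq.
Qed.

Lemma Rintegral_deriv a b P (F : R -> R) : a < b ->
  (forall t, F t = P^`().[t]) -> \int[mu]_(t in `[a, b]) F t = P.[b] - P.[a].
Proof.
move=> ab FP; rewrite /Rintegral (@continuous_FTC2 _ _ (horner P)) //.
- exact: within_continuous_poly FP.
- split=> [x _| |]; first exact: derivable_horner.
  + by apply: cvg_at_right_filter; exact: continuous_horner.
  + by apply: cvg_at_left_filter; exact: continuous_horner.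
- by move=> x _; rewrite -derive.derivE FP.
Qed.

Lemma Rintegral_deg1 a b q (F : R -> R) : a < b -> (size q <= 2)%N ->
  (forall t, F t = q.[t]) ->
  \int[mu]_(t in `[a, b]) F t = (b - a) * ((F a + F b) / 2).
Proof.
move=> ab sq Fq; have qE t : q.[t] = q`_0 + q`_1 * t.
  by rewrite (horner_coef_wide _ sq) !big_ord_recl !big_ord0 /= expr0 expr1 mulr1 addr0.
rewrite (Rintegral_deriv (P := q`_0 *: 'X + (q`_1 / 2) *: 'X ^+ 2) ab); last first.
  by move=> t; rewrite Fq qE !poly.derivE !hornerE; field.
by rewrite !Fq !qE !(hornerD, hornerZ, hornerXn, hornerX); field.
Qed.

(* The constant 1/9 is the minimum of the integral over [0, 1] of the square
   of a quadratic polynomial that equals 1 at an endpoint. *)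
Lemma Rintegral_deg2_ge a b e q (F : R -> R) : a < b -> e = a \/ e = b ->
  (size q <= 3)%N -> (forall t, F t = q.[t] ^+ 2) ->
  (b - a) / 9 * q.[e] ^+ 2 <= \int[mu]_(t in `[a, b]) F t.
Proof.
move=> ab eab sq Fq.
set d0 := q.[e]; pose d2 := q`_2; pose d1 := q`_1 + 2 * d2 * e.
have qE t : q.[t] = q`_0 + q`_1 * t + q`_2 * t ^+ 2.
  rewrite (horner_coef_wide _ sq) !big_ord_recl !big_ord0 /= expr0 expr1 mulr1 addr0.
  by rewrite addrA.
have qT t : q.[t] = d0 + d1 * (t - e) + d2 * (t - e) ^+ 2.
  by rewrite /d0 !qE /d1 /d2; ring.
have [Y [dY Yt]] : exists Y : {poly R}, Y^`() = 1 /\ forall t, Y.[t] = t - e.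
  by exists ('X - e%:P); split=> [|t]; [exact: derivXsubC|exact: hornerXsubC].
pose P := (d0 ^+ 2) *: Y + (d0 * d1) *: Y ^+ 2 + ((d1 ^+ 2 + 2 * d0 * d2) / 3) *: Y ^+ 3
  + (d1 * d2 / 2) *: Y ^+ 4 + (d2 ^+ 2 / 5) *: Y ^+ 5.
rewrite (Rintegral_deriv (P := P) ab); last first.
  move=> t; rewrite Fq qT /P !(derivD, derivZ, deriv_exp) dY /=.
  rewrite !(hornerD, hornerZ, hornerMn, hornerM, horner_exp, Yt, hornerC).
  by field.
rewrite /P !(hornerD, hornerZ, horner_exp, Yt).
(* The difference of the two sides is b - a times a quadratic form in [d0] and the Taylor
   coefficients e1, e2 of [q] at [e], rescaled to length one (signed length a - b at e = b).
   Completing the square in e1, then in [d0], leaves exactly these two squares. *)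
pose sos e1 e2 := (e1 + 3 / 2 * d0 + 3 / 4 * e2) ^+ 2 / 3 + 5 / 36 * (d0 - 3 / 10 * e2) ^+ 2.
have sos_ge0 e1 e2 : 0 <= sos e1 e2.
  by rewrite addr_ge0// mulr_ge0// ?sqr_ge0// invr_ge0.
rewrite -subr_ge0.
have ba : 0 <= b - a by rewrite subr_ge0 ltW.
case: eab => eE.
- have := mulr_ge0 ba (sos_ge0 (d1 * (b - a)) (d2 * (b - a) ^+ 2)).
  by congr (0 <= _); rewrite /sos eE; field.
- have := mulr_ge0 ba (sos_ge0 (d1 * (a - b)) (d2 * (a - b) ^+ 2)).
  by congr (0 <= _); rewrite /sos eE; field.
Qed.

End PolynomialIntegral.

Arguments integrable_poly {R a b F} q _.

(** * Iterated integrals, one direction at a time *)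

Section IteratedIntegral.
Context (R : realType) (n : nat).
Implicit Types (p q : mpoly n R) (i l : 'I_n) (x : 'rV[R]_n) (s : seq 'I_n)
  (f : box R n) (a b : R).
Local Notation mu := (@lebesgue_measure R).

Lemma integrable_line a b i x p :
  mu.-integrable `[a, b] (EFin \o (fun t => peval p (upd x i t))).
Proof. by apply: (integrable_poly (slice i x p)) => t; rewrite horner_slice. Qed.

(** Integrating out one variable of a polynomial leaves a polynomial, so every inner integral of
    [iter_int] is polynomial in the remaining variables; this settles all integrability side
    conditions. *)
Lemma Rintegral_line a b i p : exists p', forall x,
  \int[mu]_(t in `[a, b]) peval p (upd x i t) = peval p' x.
Proof.
rewrite (mpolyE p); elim/big_rec : _ => [|m p1 _ [p' Hp']].
  exists 0 => x; rewrite peval0.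
  by under eq_Rintegral do rewrite peval0; rewrite Rintegral_cst// mul0r.
exists ((mcoeff m p * \int[mu]_(t in `[a, b]) (t ^+ m i))
  *: \prod_(l | l != i) (mpolyX R (mnm1 l)) ^+ m l + p') => x.
under eq_Rintegral do rewrite pevalD.
rewrite RintegralD//; [|exact: integrable_line..].
rewrite Hp' pevalD; congr (_ + _); rewrite pevalZ peval_prod.
rewrite mulrAC -RintegralZl//; last first.
  by apply: (integrable_poly ('X ^+ m i)) => t; rewrite hornerXn.
apply: eq_Rintegral => t _; rewrite pevalZ -mulrA; congr (_ * _).
rewrite /peval mevalX (bigD1 i)//= updE eqxx mulrC; congr (_ * _).
apply: eq_bigr => l li; rewrite updE (negbTE li).
by elim: (m l) => [|k IH]; rewrite ?expr0 ?meval1// !exprS mevalM mevalXU IH.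
Qed.

Lemma iter_int_poly f s p : exists p', forall x, iter_int f s (peval p) x = peval p' x.
Proof.
elim: s => [|i s [p' Hp']] /=; first by exists p.
have [p'' Hp''] := Rintegral_line (f.1 0 i) (f.2 0 i) i p'.
by exists p'' => x; rewrite -Hp''; apply: eq_Rintegral => t _; rewrite Hp'.
Qed.

Lemma integrable_iter_int f s p a b i x :
  mu.-integrable `[a, b] (EFin \o (fun t => iter_int f s (peval p) (upd x i t))).
Proof.
have [p' Hp'] := iter_int_poly f s p.
by apply: (integrable_poly (slice i x p')) => t; rewrite Hp' horner_slice.
Qed.

Lemma iter_intD f s p q x : iter_int f s (peval (p + q)) x =
  iter_int f s (peval p) x + iter_int f s (peval q) x.
Proof.
elim: s x => [|i s IH] x /=; first exact: pevalD.
rewrite -RintegralD//; [|exact: integrable_iter_int..].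
by apply: eq_Rintegral => t _; rewrite IH.
Qed.

Lemma iter_intZ f s c p x : iter_int f s (peval (c *: p)) x =
  c * iter_int f s (peval p) x.
Proof.
elim: s x => [|i s IH] x /=; first exact: pevalZ.
rewrite -RintegralZl//; last exact: integrable_iter_int.
by apply: eq_Rintegral => t _; rewrite IH.
Qed.

Lemma le_iter_int f s p q x :
  (forall y : 'rV[R]_n, (forall l, l \notin s -> y 0 l = x 0 l) ->
    (forall l, l \in s -> f.1 0 l <= y 0 l <= f.2 0 l) -> peval p y <= peval q y) ->
  iter_int f s (peval p) x <= iter_int f s (peval q) x.
Proof.
elim: s x => [|i s IH] x /= pq; first exact: pq.
apply: le_Rintegral => //; [exact: integrable_iter_int..|].
move=> t; rewrite /= in_itv /= => tab; apply: IH => y yN yI; apply: pq => l.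
  by rewrite inE negb_or => /andP[/negbTE li /yN ->]; rewrite mxE li.
rewrite inE => /predU1P[->|]; last exact: yI.
have [/yI//|/yN ->] := boolP (i \in s); by rewrite mxE eqxx.
Qed.

Definition mix s (B : {set 'I_n}) f x : 'rV[R]_n :=
  \row_l (if l \in s then vertex f B 0 l else x 0 l).

Lemma mix_upd i s B f x t : i \notin s ->
  mix s B f (upd x i t) = upd (mix s B f x) i t.
Proof.
move=> si; apply/rowP => l; rewrite !mxE; case: (eqVneq l i) => // ->.
by rewrite (negbTE si).
Qed.

Lemma mix_cons i s B f x :
  mix (i :: s) B f x = upd (mix s B f x) i (vertex f B 0 i).
Proof.
by apply/rowP => l; rewrite !mxE inE; case: (eqVneq l i) => // ->.
Qed.

Lemma mix_setU1 i s B f x : i \notin s -> mix s (i |: B) f x = mix s B f x.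
Proof.
move=> si; apply/rowP => l; rewrite !mxE !inE; case: (eqVneq l i) => //= ->.
by rewrite (negbTE si).
Qed.

Lemma mix_setD1 i s B f x : i \notin s -> mix s (B :\ i) f x = mix s B f x.
Proof.
move=> si; apply/rowP => l; rewrite !mxE !inE; case: (eqVneq l i) => //= ->.
by rewrite (negbTE si).
Qed.

(** The inner integral is bounded below by a constant times the square of the slice of [p] in
    direction i, which is still at most quadratic, so the one-dimensional bound applies again and
    contributes its own factor 1/9. *)
Lemma iter_int_deg2_ge f s p B x : uniq s ->
  (forall i, i \in s -> dle i 2 p /\ f.1 0 i < f.2 0 i) ->
  (\prod_(i <- s) ((f.2 0 i - f.1 0 i) / 9)) * peval p (mix s B f x) ^+ 2
  <= iter_int f s (peval (p ^+ 2)) x.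
Proof.
elim: s x => [|i s IH] x /=.
  move=> _ _; rewrite big_nil mul1r (_ : mix _ _ _ _ = x); last first.
    by apply/rowP => l; rewrite mxE.
  by rewrite !expr2 pevalM.
move=> /andP[si us] hs; rewrite big_cons mix_cons.
have [p2 fi] := hs i (mem_head _ _).
set K := \prod_(_ <- s) _.
have K0 : 0 <= K.
  rewrite /K big_seq prodr_ge0// => l ls.
  by rewrite divr_ge0// subr_ge0 ltW//; apply: (hs l _).2; rewrite inE ls orbT.
have sq := size_slice (mix s B f x) p2.
have eq : vertex f B 0 i = f.1 0 i \/ vertex f B 0 i = f.2 0 i.
  by rewrite mxE; case: ifP; [right|left].
have -> : (f.2 0 i - f.1 0 i) / 9 * K * peval p (upd (mix s B f x) i (vertex f B 0 i)) ^+ 2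
  = K * ((f.2 0 i - f.1 0 i) / 9 * (slice i (mix s B f x) p).[vertex f B 0 i] ^+ 2).
  by rewrite horner_slice; ring.
pose F t := (slice i (mix s B f x) p).[t] ^+ 2.
apply: (le_trans (ler_wpM2l K0 (Rintegral_deg2_ge (F := F) fi eq sq (fun=> erefl)))).
have Fi := @integrable_poly R (f.1 0 i) (f.2 0 i) F (slice i (mix s B f x) p ^+ 2)
  (fun t => esym (horner_exp _ _ _)).
rewrite -RintegralZl//; apply: le_Rintegral => //; last first.
- move=> t _; rewrite /F horner_slice -mix_upd//; apply: IH => // l ls.
  by apply: hs; rewrite inE ls orbT.
- exact: integrable_iter_int.
- apply: (integrable_poly (K *: slice i (mix s B f x) p ^+ 2)) => t.
  by rewrite hornerZ horner_exp.
Qed.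

(** The sets [i |: B] and [B :\ i] are B and its toggle at i, in some order, and toggling is an
    involution. This turns a sum over vertices into a sum over the endpoints of edges in direction
    i. *)
Lemma sum_setU1D1 (V : nmodType) i (G : {set 'I_n} -> V) :
  \sum_(B : {set 'I_n}) (G (i |: B)%SET + G (B :\ i)%SET) = \sum_B G B + \sum_B G B.
Proof.
pose t (B : {set 'I_n}) : {set 'I_n} := if i \in B then (B :\ i)%SET else (i |: B)%SET.
have tK : involutive t.
  move=> B; rewrite /t; case: (boolP (i \in B)) => iB.
    by rewrite !inE eqxx /= finset.setD1K.
  by rewrite !inE eqxx /= setU1K.
rewrite [X in _ = X + _](reindex_inj (inv_inj tK)) -big_split /=.
apply: eq_bigr => B _; rewrite /t; case: ifPn => iB.
  by rewrite (finset.setUidPr _) ?finset.sub1set// addrC.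
congr (_ + G _); apply/finset.setP => l; rewrite !inE.
by case: eqP => // ->; rewrite (negbTE iB).
Qed.

Lemma sumr_set_const (c : R) : \sum_(B : {set 'I_n}) c = 2 ^+ n * c.
Proof.
rewrite sumr_const -cardsT -powersetT card_powerset cardsT card_ord.
by rewrite -[LHS]mulr_natl natrX.
Qed.

(** The sum runs over all subsets of the n directions although only B cap s matters: every vertex in
    the directions s is counted equally often, so the factor 2^-n yields the mean whatever the
    number of directions. *)
Lemma iter_int_deg1 f s p x : uniq s ->
  (forall i, i \in s -> dle i 1 p /\ f.1 0 i < f.2 0 i) ->
  iter_int f s (peval p) x = \prod_(i <- s) (f.2 0 i - f.1 0 i) *
    (2 ^- n * \sum_(B : {set 'I_n}) peval p (mix s B f x)).
Proof.
elim: s x => [|i s IH] x /=.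
  move=> _ _; rewrite big_nil mul1r (eq_bigr (fun=> peval p x)) => [|B _]; last first.
    by congr peval; apply/rowP => l; rewrite mxE.
  by rewrite sumr_set_const mulKf ?expf_neq0.
move=> /andP[si us] hs.
have [p1 fi] := hs i (mem_head _ _).
have hs' l : l \in s -> dle l 1 p /\ f.1 0 l < f.2 0 l.
  by move=> ls; apply: hs; rewrite inE ls orbT.
pose q B := slice i (mix s B f x) p.
have IHs t : iter_int f s (peval p) (upd x i t) =
    ((\prod_(i <- s) (f.2 0 i - f.1 0 i) * 2 ^- n) *: \sum_B q B).[t].
  rewrite IH// hornerZ mulrA horner_sum; congr (_ * _).
  by apply: eq_bigr => B _; rewrite horner_slice mix_upd.
rewrite (Rintegral_deg1 fi _ IHs); last first.
  apply: (leq_trans (size_scale_leq _ _)).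
  by apply: (leq_trans (size_sum _ _ _)); apply/bigmax_leqP => B _; exact: size_slice.
rewrite !IHs !hornerZ big_cons -!mulrDr.
set K := \prod_(_ <- s) _.
pose G B := peval p (mix (i :: s) B f x).
have -> : (\sum_B q B).[f.1 0 i] + (\sum_B q B).[f.2 0 i] = \sum_B G B + \sum_B G B.
  rewrite -(sum_setU1D1 i) !horner_sum -big_split; apply: eq_bigr => B _ /=.
  rewrite addrC /q /G !horner_slice !mix_cons mix_setU1// mix_setD1//.
  by rewrite !mxE !inE eqxx.
by rewrite /G; field; exact: expf_neq0.
Qed.

End IteratedIntegral.

(** * Integrals over boxes and their faces *)

Section BoxIntegral.
Context (R : realType) (n : nat).
Implicit Types (p q : mpoly n R) (f : box R n).

(** Faces have intervals reduced to points; only reversed intervals are excluded. *)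
Definition proper f := forall i, f.1 0 i <= f.2 0 i.

Definition face_vol f : R := \prod_(i in dirs f) (f.2 0 i - f.1 0 i).

Lemma dirsP f i : (i \in dirs f) = (f.1 0 i < f.2 0 i).
Proof. by rewrite inE. Qed.

Lemma face_vol_gt0 f : 0 < face_vol f.
Proof. by apply: prodr_gt0 => i; rewrite dirsP subr_gt0. Qed.

Lemma mix_dirs f (B : {set 'I_n}) : proper f -> mix (enum (dirs f)) B f f.1 = vertex f B.
Proof.
move=> hf; apply/rowP => i; rewrite mxE mem_enum dirsP.
case: ltP => // hi; rewrite mxE; case: ifP => // _.
by apply/eqP; rewrite eq_le hf hi.
Qed.

Lemma box_intD f p q : box_int f (peval (p + q)) = box_int f (peval p) + box_int f (peval q).
Proof. exact: iter_intD. Qed.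

Lemma box_intZ f c p : box_int f (peval (c *: p)) = c * box_int f (peval p).
Proof. exact: iter_intZ. Qed.

Lemma box_int0 f : box_int f (peval (0 : mpoly n R)) = 0.
Proof. by rewrite -(scale0r 0) box_intZ mul0r. Qed.

Lemma box_int_sum f I (r : seq I) (P : pred I) (F : I -> mpoly n R) :
  box_int f (peval (\sum_(k <- r | P k) F k)) = \sum_(k <- r | P k) box_int f (peval (F k)).
Proof.
exact: (big_morph (fun p => box_int f (peval p)) (box_intD f) (box_int0 f)).
Qed.

Lemma box_int_deg1 f p : proper f -> (forall i, i \in dirs f -> dle i 1 p) ->
  box_int f (peval p) = face_vol f * (2 ^- n * \sum_(B : {set 'I_n}) peval p (vertex f B)).
Proof.
move=> hf p1; rewrite /box_int iter_int_deg1 ?enum_uniq//; last first.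
  by move=> i; rewrite mem_enum => idf; split; [exact: p1|rewrite -dirsP].
rewrite big_enum /=; congr (_ * (_ * _)).
by apply: eq_bigr => B _; rewrite mix_dirs.
Qed.

Lemma box_int_cst f (a : R) : proper f -> box_int f (peval (mpolyC n a)) = face_vol f * a.
Proof.
move=> hf; rewrite box_int_deg1//; last by move=> i _; apply: (@dleW _ _ _ 0 1) => //; exact: dleC.
under eq_bigr do rewrite pevalC.
by rewrite sumr_set_const mulKf ?expf_neq0.
Qed.

Lemma box_int_sq_ge f p (B : {set 'I_n}) : proper f -> (forall i, i \in dirs f -> dle i 2 p) ->
  face_vol f / 9 ^+ #|dirs f| * peval p (vertex f B) ^+ 2 <= box_int f (peval (p ^+ 2)).
Proof.
move=> hf p2; rewrite -(mix_dirs B hf).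
have hs i : i \in enum (dirs f) -> dle i 2 p /\ f.1 0 i < f.2 0 i.
  by rewrite mem_enum => idf; split; [exact: p2|rewrite -dirsP].
apply: le_trans (iter_int_deg2_ge B f.1 (enum_uniq _) hs).
by rewrite big_enum /= big_split /= prodr_const -exprVn.
Qed.

Lemma le_box_int f p q : proper f ->
  (forall x, box_set f x -> peval p x <= peval q x) ->
  box_int f (peval p) <= box_int f (peval q).
Proof.
move=> hf pq; apply: le_iter_int => y yN yI; apply: pq => i.
have [/yI//|/yN ->] := boolP (i \in enum (dirs f)).
by rewrite lexx hf.
Qed.

End BoxIntegral.

(** * Exterior derivative, Koszul operator and Cartan's formula *)

Section FormCalculus.
Context (R : realType) (n : nat).
Implicit Types (u v w b e q : Defs.form R n) (i l : 'I_n) (sigma tau : {set 'I_n})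
  (c : 'rV[R]_n).

Lemma wsign_sq tau i : wsign R tau i * wsign R tau i = 1.
Proof. by rewrite /wsign -expr2 sqrr_sign. Qed.

Lemma wsign_setD1 tau i l : l \in tau ->
  wsign R (tau :\ l)%SET i = wsign R tau i * (-1) ^+ (l < i)%N.
Proof.
move=> lt; rewrite /wsign.
rewrite [in RHS](cardsD1 l) !inE lt /= exprD mulrAC -signr_addb addbb mul1r.
by congr (_ ^+ #|pred_of_set _|); apply/finset.setP => k; rewrite !inE andbA.
Qed.

Lemma wsign_setD1_id tau i : wsign R (tau :\ i)%SET i = wsign R tau i.
Proof.
rewrite /wsign; congr (_ ^+ #|pred_of_set _|); apply/finset.setP => k; rewrite !inE.
by case: eqP => // ->; rewrite ltnn !andbF.
Qed.

Lemma wsign_setU1 tau i l : l \notin tau ->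
  wsign R (l |: tau)%SET i = wsign R tau i * (-1) ^+ (l < i)%N.
Proof.
move=> lt; have := @wsign_setD1 (l |: tau)%SET i l (setU11 _ _).
by rewrite setU1K// => ->; rewrite -mulrA -expr2 sqrr_sign mulr1.
Qed.

Lemma wsign_setD1D1 tau i l : i \in tau -> l \in tau -> i != l ->
  wsign R tau i * wsign R (tau :\ i)%SET l = - (wsign R tau l * wsign R (tau :\ l)%SET i).
Proof.
move=> it lt il; rewrite !wsign_setD1//.
have [h|h|/val_inj h] := ltngtP i l; last by rewrite h eqxx in il.
- by rewrite expr1 expr0; ring.
- by rewrite expr1 expr0; ring.
Qed.

(** This sign makes the exchange terms of d kappa and kappa d cancel in [homotopy]. *)
Lemma wsign_setD1U1 tau i l : i \notin tau -> l \in tau ->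
  wsign R tau l * wsign R (tau :\ l)%SET i = - (wsign R tau i * wsign R (i |: tau)%SET l).
Proof.
move=> it lt; rewrite wsign_setD1// wsign_setU1//.
have [h|h|/val_inj h] := ltngtP i l; last by rewrite h lt in it.
- by rewrite expr1 expr0; ring.
- by rewrite expr1 expr0; ring.
Qed.

Lemma formDE u v sigma : (u + v) sigma = u sigma + v sigma.
Proof. by rewrite ffunE. Qed.
Lemma formBE u v sigma : (u - v) sigma = u sigma - v sigma.
Proof. by rewrite !ffunE. Qed.
Lemma formZE (a : R) u sigma : (a *: u) sigma = a *: u sigma.
Proof. by rewrite ffunE. Qed.

Lemma mderiv_sum I (r : seq I) (P : pred I) (F : I -> mpoly n R) l :
  mderiv l (\sum_(k <- r | P k) F k) = \sum_(k <- r | P k) mderiv l (F k).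
Proof. exact: (big_morph (mderiv l) (mderivD l) (mderiv0 _ l)). Qed.

Lemma dextD u v : dext (u + v) = dext u + dext v.
Proof.
apply/ffunP => tau; rewrite formDE !ffunE -big_split; apply: eq_bigr => i _ /=.
by rewrite formDE mderivD scalerDr.
Qed.

Lemma dextZ (a : R) u : dext (a *: u) = a *: dext u.
Proof.
apply/ffunP => tau; rewrite formZE !ffunE scaler_sumr; apply: eq_bigr => i _ /=.
by rewrite formZE mderivZ !scalerA mulrC.
Qed.

Lemma dextB u v : dext (u - v) = dext u - dext v.
Proof. by rewrite -scaleN1r dextD dextZ scaleN1r. Qed.

Lemma dext_dext u : dext (dext u) = 0.
Proof.
apply/ffunP => tau; rewrite [RHS]ffunE ffunE.
set S := \sum_(_ in _) _.
pose F i l := (wsign R tau i * wsign R (tau :\ i)%SET l) *: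
  mderiv i (mderiv l (u (tau :\ i :\ l)%SET)).
have SE : S = \sum_(i in tau) \sum_(l in (tau :\ i)%SET) F i l.
  apply: eq_bigr => i _; rewrite ffunE mderiv_sum scaler_sumr.
  by apply: eq_bigr => l _; rewrite mderivZ scalerA.
have : S = - S.
  rewrite {1}SE (exchange_big_dep (mem tau)) /=; last first.
    by move=> i l _; rewrite !inE => /andP[].
  rewrite SE -sumrN; apply: eq_bigr => l lt; rewrite -sumrN.
  rewrite (eq_bigl (fun i => i \in (tau :\ l)%SET)); last first.
    by move=> i; rewrite !inE lt andbT eq_sym andbC.
  apply: eq_bigr => i; rewrite !inE => /andP[il it].
  rewrite /F wsign_setD1D1// scaleNr mderiv_comm; congr (- (_ *: _ )).
  by congr (mderiv _ (mderiv _ (u _))); rewrite !finset.setDDl finset.setUC.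
move/eqP; rewrite -addr_eq0 -mulr2n -scaler_nat scaler_eq0 pnatr_eq0 /=.
by move/eqP.
Qed.

Definition shiftX c i : mpoly n R := mpolyX R (mnm1 i) - mpolyC n (c 0 i).

Lemma mderiv_shiftX c i l : mderiv l (shiftX c i) = (i == l)%:R.
Proof.
rewrite mderivB mderivC subr0 mderivX mnm1E; case: eqP => [->|_].
  have -> : mnm_sub (mnm1 l) (mnm1 l) = @mnm0 n.
    by apply/mnmP => k; rewrite mnmBE subnn mnm0E.
  by rewrite mpolyX0 scale1r.
by rewrite scale0r.
Qed.

(** Contraction with the field x - c. [S1p] is defined with c = 0, whereas evaluation at the
    vertices of T calls for c = [T.1]. *)
Definition koszul_at c u : Defs.form R n :=
  [ffun tau : {set 'I_n} =>
     \sum_(i | i \notin tau) wsign R tau i *: (shiftX c i * u (i |: tau)%SET)].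

Lemma koszul_at0 u : koszul_at 0 u = koszul u.
Proof.
apply/ffunP => tau; rewrite !ffunE; apply: eq_bigr => i _.
by rewrite /shiftX mxE mpolyC0 subr0.
Qed.

Lemma koszul_atD c u v : koszul_at c (u + v) = koszul_at c u + koszul_at c v.
Proof.
apply/ffunP => tau; rewrite formDE !ffunE -big_split; apply: eq_bigr => i _ /=.
by rewrite formDE mulrDr scalerDr.
Qed.

Lemma koszul_atZ c (a : R) u : koszul_at c (a *: u) = a *: koszul_at c u.
Proof.
apply/ffunP => tau; rewrite formZE !ffunE scaler_sumr; apply: eq_bigr => i _ /=.
by rewrite formZE -scalerAr !scalerA mulrC.
Qed.

(** The term i = l restores the direction just removed and gives the first sum; i != l exchanges a
    direction of tau for one outside it. All degree counts and vertex evaluations below start from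
    this formula. *)
Lemma dext_koszul_at c u tau : dext (koszul_at c u) tau =
  \sum_(l in tau) (u tau + shiftX c l * mderiv l (u tau)) +
  \sum_(l in tau) \sum_(i | i \notin tau)
    (wsign R tau l * wsign R (tau :\ l)%SET i) *:
      (shiftX c i * mderiv l (u (i |: (tau :\ l))%SET)).
Proof.
rewrite ffunE -big_split; apply: eq_bigr => l lt /=.
rewrite ffunE mderiv_sum scaler_sumr (bigD1 l) /=; last by rewrite !inE eqxx.
rewrite mderivZ scalerA wsign_setD1_id wsign_sq scale1r finset.setD1K//.
rewrite mderivM mderiv_shiftX eqxx mul1r; congr (_ + _).
apply: eq_big => [i|i].
  by rewrite !inE negb_and negbK; case: (eqVneq i l) => [->|]; rewrite ?lt ?andbT //= andbF.
rewrite !inE => /andP[_ il].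
by rewrite mderivZ scalerA mderivM mderiv_shiftX (negbTE il) mul0r add0r.
Qed.

Lemma koszul_at_dext c u tau : koszul_at c (dext u) tau =
  \sum_(i | i \notin tau) shiftX c i * mderiv i (u tau) -
  \sum_(l in tau) \sum_(i | i \notin tau)
    (wsign R tau l * wsign R (tau :\ l)%SET i) *:
      (shiftX c i * mderiv l (u (i |: (tau :\ l))%SET)).
Proof.
rewrite ffunE exchange_big -sumrB; apply: eq_bigr => i it /=; rewrite ffunE.
rewrite big_setU1//= mulrDr scalerDr setU1K// -scalerAr scalerA.
have -> : wsign R (i |: tau)%SET i = wsign R tau i.
  by rewrite wsign_setU1// ltnn mulr1.
rewrite wsign_sq scale1r; congr (_ + _); rewrite mulr_sumr scaler_sumr -sumrN.
apply: eq_bigr => l lt; rewrite -scalerAr scalerA -scaleNr wsign_setD1U1// opprK.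
congr (_ *: (_ * mderiv _ (u _))).
apply/finset.setP => k; rewrite !inE; case: (eqVneq k i) => [->|//].
by rewrite andbT; apply: contraNneq it => ->.
Qed.

(* Cartan's formula: the sum is the Lie derivative along the field x - c. *)
Lemma homotopy c u tau : (dext (koszul_at c u) + koszul_at c (dext u)) tau =
  u tau *+ #|tau| + \sum_i shiftX c i * mderiv i (u tau).
Proof.
rewrite formDE dext_koszul_at koszul_at_dext addrACA subrr addr0 big_split /=.
by rewrite sumr_const -addrA; congr (_ + _); rewrite [RHS](bigID (mem tau)).
Qed.

End FormCalculus.

(** * Multilinear monomials in rescaled coordinates *)

Section Monomials.
Context (R : realType) (n : nat) (c h : 'rV[R]_n) (h0 : forall i, h 0 i != 0).
Implicit Types (p q : mpoly n R) (i l : 'I_n) (A B S : {set 'I_n}) (x : 'rV[R]_n).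

Definition Yvar i : mpoly n R := (h 0 i)^-1 *: shiftX c i.

Definition Ymon A : mpoly n R := \prod_(i in A) Yvar i.

Lemma shiftXE i : shiftX c i = h 0 i *: Yvar i.
Proof. by rewrite scalerA divff// scale1r. Qed.

Lemma peval_shiftX i x : peval (shiftX c i) x = x 0 i - c 0 i.
Proof. by rewrite pevalB pevalXU pevalC. Qed.

Lemma peval_Yvar i x : peval (Yvar i) x = (x 0 i - c 0 i) / h 0 i.
Proof. by rewrite pevalZ peval_shiftX mulrC. Qed.

Lemma peval_Ymon A x : peval (Ymon A) x = \prod_(i in A) ((x 0 i - c 0 i) / h 0 i).
Proof. by rewrite peval_prod; apply: eq_bigr => i _; rewrite peval_Yvar. Qed.

Lemma dle_shiftX i l : dle i (i == l) (shiftX c l).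
Proof.
by apply: dleB; [exact: dleXU|apply: (@dleW _ _ _ 0) => //; exact: dleC].
Qed.

Lemma dle_Yvar i l : dle i (i == l) (Yvar l).
Proof. exact/dleZ/dle_shiftX. Qed.

Lemma YmonD1 i A : i \in A -> Ymon A = Yvar i * Ymon (A :\ i)%SET.
Proof. exact: big_setD1. Qed.

Lemma dle0_Ymon i A : i \notin A -> dle i 0 (Ymon A).
Proof.
move=> iA; rewrite /Ymon; elim/big_rec : _ => [|l p lA ip].
  by rewrite -mpolyC1; exact: dleC.
have := dleM (@dle_Yvar i l) ip; suff /negbTE -> : i != l by [].
by apply: contraNneq iA => ->.
Qed.

Lemma dle_Ymon i A : dle i (i \in A) (Ymon A).
Proof.
have [iA|/dle0_Ymon//] := boolP (i \in A).
rewrite (YmonD1 iA); apply: (@dleM _ _ _ 1 0).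
  by have := @dle_Yvar i i; rewrite eqxx.
by apply: dle0_Ymon; rewrite !inE eqxx.
Qed.

Lemma Q1_Ymon S A : A \subset S -> Q1 S (Ymon A).
Proof.
move=> AS; apply: (Q1W AS); apply/Q1P => i; exact: dle_Ymon.
Qed.

Lemma Q1_sum S I (r : seq I) (P : pred I) (F : I -> mpoly n R) :
  (forall k, P k -> Q1 S (F k)) -> Q1 S (\sum_(k <- r | P k) F k).
Proof.
by move=> FS; apply/Q1P => i; apply: dle_sum => k Pk; move: i; apply/Q1P; exact: FS.
Qed.

Lemma Q1Z S (a : R) p : Q1 S p -> Q1 S (a *: p).
Proof. by move=> /Q1P Sp; apply/Q1P => i; exact: dleZ. Qed.

Lemma Q1D S p q : Q1 S p -> Q1 S q -> Q1 S (p + q).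
Proof. by move=> /Q1P Sp /Q1P Sq; apply/Q1P => i; exact: dleD. Qed.

Lemma Q1_0 S : Q1 S (0 : mpoly n R).
Proof. by apply/Q1P => i; exact: dle0. Qed.

Lemma Q1_Ymon_expansion S p : Q1 S p -> exists e : {set 'I_n} -> R,
  (forall A, ~~ (A \subset S) -> e A = 0) /\ p = \sum_A e A *: Ymon A.
Proof.
move=> Sp; rewrite (mpolyE p) big_seq.
elim/big_rec : _ => [|m p1 mp [e [eS ->]]].
  by exists (fun=> 0); split=> //; rewrite big1 // => A _; rewrite scale0r.
(* Each factor of the monomial x^m is written as a multiple of Y_i plus a constant: h_i Y_i + c_i if
   m_i = 1, and 0 Y_i + 1 if m_i = 0. Expanding the product, [e' A] collects the choice of the
   Y-term exactly for i in A. *)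
pose e' A := \prod_i (if i \in A then (if m i == 0%N then 0 else h 0 i)
  else if m i == 0%N then 1 else c 0 i).
exists (fun A => mcoeff m p * e' A + e A); split=> [A AS|].
  rewrite eS// addr0; have /fintype.subsetPn[i iA iS] := AS.
  rewrite /e' (bigD1 i)//= iA.
  by have := Sp m mp i; rewrite (negbTE iS) leqn0 => ->; rewrite mul0r mulr0.
under [RHS]eq_bigr do rewrite scalerDl -scalerA.
rewrite big_split /= -scaler_sumr; congr (_ *: _ + _).
rewrite mpolyXE_id.
rewrite (eq_bigr (fun i => (if m i == 0%N then 0 else h 0 i) *: Yvar i +
   mpolyC n (if m i == 0%N then 1 else c 0 i))); last first.
  move=> i _; have := Sp m mp i; case: (m i) => [|[|k]] /=; last by case: (_ \in _).
    by rewrite scale0r add0r mpolyC1 expr0.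
  by rewrite expr1 -shiftXE subrK.
rewrite bigA_distr; apply: eq_bigr => A _.
rewrite /Ymon [X in _ *: X]big_mkcond /= -scaler_prod; apply: eq_bigr => i _.
by case: ifP => // _; rewrite -mul_mpolyC mulr1.
Qed.

Lemma mderiv_deg0 l p : dle l 0 p -> mderiv l p = 0.
Proof.
move=> lp; apply/mpolyP => m; rewrite mcoeff0 mcoeff_deriv.
have [/lp|/memN_msupp_eq0 ->] := boolP (mnm_add m (mnm1 l) \in msupp p).
  by rewrite mnmDE mnm1E eqxx addn1.
by rewrite mul0rn.
Qed.

Lemma mderiv_Ymon l A : mderiv l (Ymon A) =
  if l \in A then (h 0 l)^-1 *: Ymon (A :\ l)%SET else 0.
Proof.
case: ifPn => [lA|/dle0_Ymon/mderiv_deg0//].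
rewrite (YmonD1 lA) mderivM (mderiv_deg0 (p := Ymon _)) ?mulr0 ?addr0.
  by rewrite mderivZ mderiv_shiftX eqxx -scalerAl mul1r.
by apply: dle0_Ymon; rewrite !inE eqxx.
Qed.

Lemma shiftX_mderiv_Ymon l A : shiftX c l * mderiv l (Ymon A) = Ymon A *+ (l \in A).
Proof.
rewrite mderiv_Ymon; case: ifPn => lA; last by rewrite mulr0.
by rewrite shiftXE -scalerAl -scalerAr scalerA divff// scale1r -YmonD1.
Qed.

Definition mlf (e : {set 'I_n} -> {set 'I_n} -> R) : Defs.form R n :=
  [ffun sigma : {set 'I_n} => \sum_A e sigma A *: Ymon A].

Lemma mlfE e sigma : mlf e sigma = \sum_A e sigma A *: Ymon A.
Proof. by rewrite ffunE. Qed.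

End Monomials.

(** * The local spaces and their independence of the origin *)

Section Spaces.
Context (R : realType) (n : nat).
Implicit Types (p : mpoly n R) (u v w b q : Defs.form R n) (i l : 'I_n)
  (sigma tau A B : {set 'I_n}) (c h : 'rV[R]_n) (j : nat).

Definition multilinear j b := is_form j b /\ forall sigma, Q1 finset.setT (b sigma).

Lemma is_formD j u v : is_form j u -> is_form j v -> is_form j (u + v).
Proof. by move=> ju jv s sj; rewrite formDE ju// jv// addr0. Qed.

Lemma is_formZ j (a : R) u : is_form j u -> is_form j (a *: u).
Proof. by move=> ju s sj; rewrite formZE ju// scaler0. Qed.

Lemma Q1mP j q : Q1m j q <-> is_form j q /\ forall sigma, Q1 (~: sigma)%SET (q sigma).
Proof.
split=> -[jq hq]; split=> // sigma.
  by have [/hq//|/eqP /jq ->] := eqVneq #|sigma| j; exact: Q1_0.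
Qed.

Lemma Q1mD j u v : Q1m j u -> Q1m j v -> Q1m j (u + v).
Proof.
move=> /Q1mP[ju hu] /Q1mP[jv hv]; apply/Q1mP; split; first exact: is_formD.
by move=> s; rewrite formDE; exact: Q1D.
Qed.

Lemma Q1mZ j (a : R) u : Q1m j u -> Q1m j (a *: u).
Proof.
move=> /Q1mP[ju hu]; apply/Q1mP; split; first exact: is_formZ.
by move=> s; rewrite formZE; exact: Q1Z.
Qed.

Lemma multilinearD j u v : multilinear j u -> multilinear j v -> multilinear j (u + v).
Proof.
move=> [ju hu] [jv hv]; split; first exact: is_formD.
by move=> s; rewrite formDE; exact: Q1D.
Qed.

Lemma multilinearZ j (a : R) u : multilinear j u -> multilinear j (a *: u).
Proof.
move=> [ju hu]; split; first exact: is_formZ.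
by move=> s; rewrite formZE; exact: Q1Z.
Qed.

Lemma multilinear_mlf c h j b : (forall i, h 0 i != 0) -> multilinear j b ->
  exists e, (forall sigma A, #|sigma| <> j -> e sigma A = 0) /\ b = mlf c h e.
Proof.
move=> h0 [jb hb].
have [e he] := choice (fun sigma => Q1_Ymon_expansion c h0 (hb sigma)).
exists (fun sigma A => if #|sigma| == j then e sigma A else 0); split.
  by move=> sigma A /eqP/negbTE ->.
apply/ffunP => sigma; rewrite ffunE; case: eqP => [_|/jb ->].
  by have [_ ->] := he sigma.
by rewrite big1// => A _; rewrite scale0r.
Qed.

Lemma Q1m_mlf c h j q : (forall i, h 0 i != 0) -> Q1m j q ->
  exists e, [/\ forall sigma A, #|sigma| <> j -> e sigma A = 0,
    forall sigma A, ~~ (A \subset ~: sigma)%SET -> e sigma A = 0 & q = mlf c h e].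
Proof.
move=> h0 /Q1mP[jb hb].
have [e he] := choice (fun sigma => Q1_Ymon_expansion c h0 (hb sigma)).
exists (fun sigma A => if #|sigma| == j then e sigma A else 0); split.
- by move=> sigma A /eqP/negbTE ->.
- by move=> sigma A sA; case: ifP => // _; apply: (he sigma).1.
apply/ffunP => sigma; rewrite ffunE; case: eqP => [_|/jb ->].
  by have [_ ->] := he sigma.
by rewrite big1// => A _; rewrite scale0r.
Qed.

Lemma mlf_multilinear c h j e :
  (forall sigma A, #|sigma| <> j -> e sigma A = 0) -> multilinear j (mlf c h e).
Proof.
move=> ej; split=> sigma.
  by move=> sj; rewrite mlfE big1// => A _; rewrite ej// scale0r.
by rewrite mlfE; apply: Q1_sum => A _; apply/Q1Z/Q1_Ymon/finset.subsetT.
Qed.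

Lemma mlf_Q1m c h j e : (forall sigma A, #|sigma| <> j -> e sigma A = 0) ->
  (forall sigma A, ~~ (A \subset ~: sigma)%SET -> e sigma A = 0) -> Q1m j (mlf c h e).
Proof.
move=> ej es; apply/Q1mP; split=> sigma.
  by move=> sj; rewrite mlfE big1// => A _; rewrite ej// scale0r.
rewrite mlfE; apply: Q1_sum => A _; case: (boolP (A \subset ~: sigma)%SET) => As.
  exact/Q1Z/Q1_Ymon.
by rewrite es// scale0r; exact: Q1_0.
Qed.

Lemma mlfD c h (e e' : {set 'I_n} -> {set 'I_n} -> R) :
  mlf c h (fun s A => e s A + e' s A) = mlf c h e + mlf c h e'.
Proof.
apply/ffunP => s; rewrite formDE !mlfE -big_split; apply: eq_bigr => A _.
by rewrite scalerDl.
Qed.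

Lemma is_form_koszul_at c j b : is_form j.+1 b -> is_form j (koszul_at c b).
Proof.
move=> jb s sj; rewrite ffunE big1// => i si; rewrite jb ?mulr0 ?scaler0//.
by rewrite cardsU1 si add1n => -[].
Qed.

Lemma is_form_dext j b : is_form j b -> is_form j.+1 (dext b).
Proof.
move=> jb s sj; rewrite ffunE big1// => i si; rewrite jb ?mderiv0 ?scaler0//.
by move=> sij; apply: sj; rewrite (cardsD1 i) si sij.
Qed.

Lemma koszul_at_form0 c b : is_form 0 b -> koszul_at c b = 0.
Proof.
move=> b0; apply/ffunP => s; rewrite [RHS]ffunE ffunE big1// => i si.
by rewrite b0 ?mulr0 ?scaler0// cardsU1 si.
Qed.

Lemma dext0 : dext (0 : Defs.form R n) = 0.
Proof. by rewrite -(scale0r 0) dextZ !scale0r. Qed.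

Lemma dext_koszul_at_0 c : dext (koszul_at c (0 : Defs.form R n)) = 0.
Proof. by rewrite -(scale0r 0) koszul_atZ dextZ !scale0r. Qed.

Lemma is_form_dext_koszul_at c j b : is_form j b -> is_form j (dext (koszul_at c b)).
Proof.
case: j => [|j] jb; last exact/is_form_dext/is_form_koszul_at.
by rewrite koszul_at_form0// dext0 => s _; rewrite ffunE.
Qed.

(** Since q_tau does not depend on x_l for l in tau, the diagonal terms reduce to multiples of
    q_tau. In an exchange term, q_(i + tau - l) is free of x_i and the derivative removes x_l; the
    factor x_i - c_i then has i outside tau and makes the degree in x_i equal to at most 1. *)
Lemma Q1m_dext_koszul_at c j q : Q1m j q -> Q1m j (dext (koszul_at c q)).
Proof.
move=> /Q1mP[jq hq]; apply/Q1mP; split; first exact: is_form_dext_koszul_at.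
have dq s k : dle k (k \in ~: s)%SET (q s) by have /Q1P/(_ k) := hq s.
move=> tau; rewrite dext_koszul_at; apply: Q1D; apply: Q1_sum => l lt.
  apply: Q1D => //; rewrite mderiv_deg0 ?mulr0; first exact: Q1_0.
  by have := dq tau l; rewrite !inE lt.
apply: Q1_sum => i it; apply/Q1Z/Q1P => k.
have dk : dle k ((k \notin tau) && (k != i)) (mderiv l (q (i |: (tau :\ l))%SET)).
  have := dq (i |: (tau :\ l))%SET k; rewrite !inE.
  case: (eqVneq k l) => [->|_] /=; first by move=> hk; rewrite lt /=; apply: dle_mderivS; apply: dleW hk; exact: leq_b1.
  move=> /(dle_mderiv (l := l)); apply: dleW.
  by case: (eqVneq k i) => //= _; rewrite andbT.
apply: dleW (dleM (@dle_shiftX _ _ c k i) dk).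
by rewrite inE; case: (eqVneq k i) => [->|_]; rewrite ?it ?andbF ?andbT.
Qed.

(* On the monomials (x - c)^A dx_sigma the Lie derivative of Cartan's formula is
   multiplication by |A| + |sigma|, hence invertible away from the constants,
   which d annihilates. *)
Lemma dext_in_koszul_range c j e : multilinear j e ->
  exists2 E, multilinear j.+1 E & dext e = dext (koszul_at c E).
Proof.
pose h : 'rV[R]_n := const_mx 1; have h0 i : h 0 i != 0 by rewrite mxE oner_eq0.
move=> /(multilinear_mlf c h0)[eps [epsj ->]].
pose eps' sigma A := eps sigma A / (#|A| + #|sigma|)%:R.
pose e' := mlf c h eps'.
have e'j : multilinear j e'.
  by apply: mlf_multilinear => s A /epsj eps0; rewrite /eps' eps0 mul0r.
exists (dext e').
  split; first by apply: is_form_dext; case: e'j.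
  move=> s; rewrite ffunE; apply: Q1_sum => i _; apply/Q1Z/Q1P => k.
  by apply: dle_mderiv; have /Q1P/(_ k) := e'j.2 (s :\ i)%SET.
have -> : koszul_at c (dext e') = (dext (koszul_at c e') + koszul_at c (dext e'))
    - dext (koszul_at c e') by rewrite addrC addKr.
rewrite dextB dext_dext subr0; apply/ffunP => tau; rewrite !ffunE.
apply: eq_bigr => l lt; congr (_ *: _); rewrite homotopy.
set s := (tau :\ l)%SET.
have -> : \sum_i shiftX c i * mderiv i (e' s) = \sum_A (eps' s A * #|A|%:R) *: Ymon c h A.
  under eq_bigr => i _ do rewrite mlfE mderiv_sum mulr_sumr.
  rewrite exchange_big; apply: eq_bigr => A _ /=.
  under eq_bigr => i _ do rewrite mderivZ -scalerAr shiftX_mderiv_Ymon//.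
  rewrite -scaler_sumr -scalerA; congr (_ *: _).
  rewrite sumrMnr scaler_nat -sum1_card [in RHS]big_mkcond; congr (_ *+ _).
rewrite /e' !mlfE -sumrMnl -big_split /= !mderiv_sum; apply: eq_bigr => A _.
rewrite -scaler_nat scalerA -scalerDl mderivZ mderivZ.
have [A0|A0] := eqVneq (#|A| + #|s|)%N 0%N.
  move/eqP: A0; rewrite addn_eq0 cards_eq0 => /andP[/eqP -> _].
  by rewrite mderiv_Ymon// inE !scaler0.
congr (_ *: _); rewrite mulrC -mulrDr -natrD addnC /eps' divfK//.
by rewrite pnatr_eq0.
Qed.

(** [S1p] with origin c and with arbitrary multilinear forms in place of [Bspace], whose vanishing
    condition at 0 is not invariant under a shift of the origin. *)
Definition S1p_at c j u := exists q b,
  [/\ Q1m j q, multilinear j b & u = q + dext (koszul_at c b)].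

Lemma S1p_atD c j u v : S1p_at c j u -> S1p_at c j v -> S1p_at c j (u + v).
Proof.
move=> [q [b [hq hb ->]]] [q' [b' [hq' hb' ->]]]; exists (q + q'), (b + b'); split.
- exact: Q1mD.
- exact: multilinearD.
- by rewrite koszul_atD dextD addrACA.
Qed.

Lemma S1p_atZ c j (a : R) u : S1p_at c j u -> S1p_at c j (a *: u).
Proof.
move=> [q [b [hq hb ->]]]; exists (a *: q), (a *: b); split.
- exact: Q1mZ.
- exact: multilinearZ.
- by rewrite koszul_atZ dextZ scalerDr.
Qed.

Definition contract (v : 'rV[R]_n) u : Defs.form R n :=
  [ffun tau : {set 'I_n} =>
     \sum_(i | i \notin tau) (wsign R tau i * v 0 i) *: u (i |: tau)%SET].

Lemma koszul_at_shift c c' u : koszul_at c u = koszul_at c' u + contract (c' - c) u.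
Proof.
apply/ffunP => tau; rewrite formDE !ffunE -big_split; apply: eq_bigr => i _ /=.
rewrite -scalerA -scalerDr; congr (_ *: _); rewrite -mul_mpolyC -mulrDl; congr (_ * _).
by rewrite /shiftX !mxE raddfB /= addrA subrK.
Qed.

(** The two Koszul operators differ by contraction with a constant vector. This keeps coefficients
    multilinear and lowers the degree of the form by one, so its exterior derivative is covered by
    [dext_in_koszul_range]; on 0-forms it vanishes. *)
Lemma S1p_at_shift c c' j u : S1p_at c j u -> S1p_at c' j u.
Proof.
move=> [q [b [hq hb ->]]]; rewrite (koszul_at_shift c c') dextD addrCA addrC.
suff [E hE ->] : exists2 E, multilinear j E &
    dext (contract (c' - c) b) = dext (koszul_at c' E).
  exists q, (b + E); split=> //; first exact: multilinearD.
  by rewrite koszul_atD dextD addrCA addrC addrA addrAC.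
case: j hq hb => [|j] hq [jb hb].
  exists 0; first by split=> s *; rewrite ffunE//; exact: Q1_0.
  rewrite koszul_at_form0; last by move=> s _; rewrite ffunE.
  congr dext; apply/ffunP => s; rewrite !ffunE big1// => i si.
  by rewrite jb ?scaler0// cardsU1 si.
apply: dext_in_koszul_range; split=> s.
  move=> sj; rewrite ffunE big1// => i si; rewrite jb ?scaler0//.
  by rewrite cardsU1 si add1n => -[].
by rewrite ffunE; apply: Q1_sum => i _; exact: Q1Z.
Qed.

(** The monomials Y^A dx_sigma with A disjoint from sigma span [Q1m] and enter [S1p] as they are;
    those with A meeting sigma enter through d kappa. *)
Definition disj_part (e : {set 'I_n} -> {set 'I_n} -> R) sigma A :=
  if (A \subset ~: sigma)%SET then e sigma A else 0.

Definition meet_part (e : {set 'I_n} -> {set 'I_n} -> R) sigma A :=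
  if (A \subset ~: sigma)%SET then 0 else e sigma A.

Lemma mlf_split c h e : mlf c h e = mlf c h (disj_part e) + mlf c h (meet_part e).
Proof.
rewrite -mlfD; congr mlf; apply/funext => s; apply/funext => A.
by rewrite /disj_part /meet_part; case: ifP; rewrite ?addr0 ?add0r.
Qed.

Lemma disj_part_Q1m c h j e : (forall sigma A, #|sigma| <> j -> e sigma A = 0) ->
  Q1m j (mlf c h (disj_part e)).
Proof.
move=> ej; apply: mlf_Q1m => s A; last by rewrite /disj_part => /negbTE ->.
by rewrite /disj_part => /ej ->; rewrite if_same.
Qed.

Lemma meet_part_multilinear c h j e : (forall sigma A, #|sigma| <> j -> e sigma A = 0) ->
  multilinear j (mlf c h (meet_part e)).
Proof.
move=> ej; apply: mlf_multilinear => s A.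
by rewrite /meet_part => /ej ->; rewrite if_same.
Qed.

Lemma multilinear_dx j sigma p : #|sigma| = j -> Q1 finset.setT p -> multilinear j (dx sigma p).
Proof.
move=> sj hp; split=> s; rewrite ffunE; first by case: eqP => // -> /(_ sj).
by case: eqP => // _; exact: Q1_0.
Qed.

(** For the way back to [Bspace]: if A meets sigma, y^A is the product of y^(A - sigma) and y^(A cap
    sigma), and the second factor vanishes at 0 as [Bgen] demands. The rest of b lies in [Q1m], and
    its image under d kappa is absorbed in q. *)
Lemma S1pP c j u : S1p j u <-> S1p_at c j u.
Proof.
split.
  move=> [q [b [hq [m [a [g [hg ->]]]] ->]]]; apply: (@S1p_at_shift 0).
  exists q, (\sum_i a i *: g i); split=> //; last by rewrite koszul_at0.
  elim/big_ind : _ => [|b1 b2|i _]; [|exact: multilinearD|].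
    by split=> s *; rewrite ffunE//; exact: Q1_0.
  apply: multilinearZ; have [s [p [p' [sj hp hp' _ ->]]]] := hg i.
  apply: multilinear_dx => //; rewrite mulrC -(finset.setUCr s).
  by apply: Q1M => //; rewrite -setI_eq0 finset.setICr.
move=> /(@S1p_at_shift _ 0)[q [b [hq hb ->]]].
pose h : 'rV[R]_n := const_mx 1; have h0 i : h 0 i != 0 by rewrite mxE oner_eq0.
have [e [ej ->]] := multilinear_mlf 0 h0 hb.
rewrite mlf_split koszul_atD dextD addrA; set e1 := meet_part e; set q' := q + _.
exists q', (mlf 0 h e1); split=> //; last by rewrite koszul_at0.
  by apply: Q1mD => //; apply/Q1m_dext_koszul_at/disj_part_Q1m.
pose I := ({set 'I_n} * {set 'I_n})%type.
pose P : pred I := [pred t : {set 'I_n} * {set 'I_n} | (#|t.1| == j) && ~~ (t.2 \subset ~: t.1)%SET].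
pose gen (t : {set 'I_n} * {set 'I_n}) := dx t.1 (Ymon 0 h (t.2 :\: t.1)%SET * Ymon 0 h (t.2 :&: t.1)%SET).
have -> : mlf 0 h e1 = \sum_(t in P) e t.1 t.2 *: gen t.
  apply/ffunP => s; rewrite mlfE sum_ffunE.
  transitivity (\sum_(s' : {set 'I_n}) \sum_(A : {set 'I_n})
      (if (s', A) \in P then (e s' A *: gen (s', A)) s else 0)); last first.
    by rewrite pair_big [RHS]big_mkcond /=; apply: eq_bigr => -[].
  rewrite [RHS](bigD1 s)//= [X in _ + X]big1 ?addr0; last first.
    move=> s' s's; rewrite big1// => A _; rewrite inE /=.
    by case: ifP => // _; rewrite !ffunE eq_sym (negbTE s's) scaler0.
  apply: eq_bigr => A _; rewrite inE /=; case: (eqVneq #|s| j) => /= [_|/eqP sj].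
    rewrite /e1 /meet_part; case: ifP => /= _; first by rewrite scale0r.
    rewrite !ffunE eqxx; congr (_ *: _).
    rewrite /Ymon [LHS](bigID (mem s)) mulrC /=; congr (_ * _); apply: eq_bigl => i;
      by rewrite !inE // andbC.
  by rewrite /e1 /meet_part ej// if_same scale0r.
exists #|P|, (fun k => e (enum_val k).1 (enum_val k).2), (fun k => gen (enum_val k)).
split; last by rewrite (big_enum_val (fun t => e t.1 t.2 *: gen t)).
move=> k; have /andP[] : P (enum_val k) := enum_valP k.
set t := enum_val k => /eqP tj tn.
exists t.1, (Ymon 0 h (t.2 :&: t.1)%SET), (Ymon 0 h (t.2 :\: t.1)%SET); split=> //.
- by apply: Q1_Ymon; apply: finset.subsetIr.
- by apply: Q1_Ymon; apply/fintype.subsetP => i; rewrite !inE => /andP[].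
- have /fintype.subsetPn[i iA] := tn; rewrite inE negbK => it.
  rewrite peval_Ymon (bigD1 i) ?inE ?iA//=.
  by rewrite !mxE subr0 mul0r mul0r.
Qed.

End Spaces.

(** * Coefficients of a local form and its values at the corners *)

Section Generators.
Context (R : realType) (n : nat).
Implicit Types (u q b : Defs.form R n) (i l : 'I_n) (sigma tau rho A B C V : {set 'I_n})
  (c h x y : 'rV[R]_n) (j : nat) (a e : {set 'I_n} -> {set 'I_n} -> R).

(** One coefficient for each pair (sigma, A), hence as many parameters as there are vertex values;
    unisolvence says that the passage from one to the other is bijective. *)
Definition gen c h a : Defs.form R n :=
  mlf c h (disj_part a) + dext (koszul_at c (mlf c h (meet_part a))).

Lemma S1p_gen c h j u : (forall i, h 0 i != 0) ->
  S1p j u <-> exists a, (forall sigma A, #|sigma| <> j -> a sigma A = 0) /\ u = gen c h a.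
Proof.
move=> h0; split=> [/(S1pP c)[q [b [hq hb ->]]]|[a [aj ->]]]; last first.
  by apply/(S1pP c); exists (mlf c h (disj_part a)), (mlf c h (meet_part a)); split;
    [exact: disj_part_Q1m|exact: meet_part_multilinear|].
have [e [ej ->]] := multilinear_mlf c h0 hb.
rewrite mlf_split koszul_atD dextD addrA.
have /(Q1m_mlf c h0)[e' [e'j e's ->]] :
    Q1m j (q + dext (koszul_at c (mlf c h (disj_part e)))).
  by apply: Q1mD => //; apply/Q1m_dext_koszul_at/disj_part_Q1m.
exists (fun s A => if (A \subset ~: s)%SET then e' s A else e s A); split.
  by move=> s A sj; rewrite ej// e'j// if_same.
congr (mlf _ _ _ + dext (koszul_at _ (mlf _ _ _))); apply/funext => s; apply/funext => A.
  by rewrite /disj_part; case: (boolP (A \subset ~: s)%SET) => // /e's.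
by rewrite /meet_part; case: ifP.
Qed.

Definition ypow y A : R := \prod_(i in A) y 0 i.

(* The values of [gen c h a] in the coordinates y = (x - c) / h and the basis
   dy_tau, when [a sigma] is divided by the product of the h_i, i in sigma. *)
Definition ref a tau y : R :=
  \sum_A disj_part a tau A * ypow y A +
  \sum_(l in tau) \sum_A meet_part a tau A * (1 + (l \in A)%:R) * ypow y A +
  \sum_(l in tau) \sum_(i | i \notin tau) (wsign R tau l * wsign R (tau :\ l)%SET i) *
    \sum_A meet_part a (i |: (tau :\ l))%SET A * ((l \in A)%:R * (y 0 i * ypow y (A :\ l)%SET)).

(** Both d and contraction with x - c are invariant under the affine change to y, and dx_i = h_i
    dy_i. The edge lengths therefore appear only through the products [ypow h], and [ref] is the
    same for all boxes. *)
Lemma gen_ref c h a tau x : (forall i, h 0 i != 0) ->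
  peval (gen c h (fun s A => a s A / ypow h s) tau) x =
  ref a tau (\row_i ((x 0 i - c 0 i) / h 0 i)) / ypow h tau.
Proof.
move=> h0; set y := \row_i _.
have ypE A : peval (Ymon c h A) x = ypow y A.
  by rewrite peval_Ymon; apply: eq_bigr => i _; rewrite mxE.
pose ah s A := a s A / ypow h s.
have dE s A : disj_part ah s A = disj_part a s A / ypow h s.
  by rewrite /disj_part; case: ifP; rewrite ?mul0r.
have mE s A : meet_part ah s A = meet_part a s A / ypow h s.
  by rewrite /meet_part; case: ifP; rewrite ?mul0r.
rewrite /gen formDE dext_koszul_at /ref !mulrDl addrA !pevalD !peval_sum; congr (_ + _ + _).
- rewrite mlfE peval_sum mulr_suml; apply: eq_bigr => A _.
  by rewrite pevalZ ypE dE mulrAC.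
- rewrite mulr_suml; apply: eq_bigr => l _.
  rewrite mlfE mderiv_sum mulr_sumr -big_split peval_sum mulr_suml.
  apply: eq_bigr => A _ /=.
  rewrite mderivZ -scalerAr (shiftX_mderiv_Ymon c h0) -scalerDr pevalZ pevalD mE.
  by rewrite /peval mevalMn -/(peval _ _) ypE -mulr_natr; ring.
rewrite mulr_suml; apply: eq_bigr => l lt; rewrite peval_sum mulr_suml; apply: eq_bigr => i it.
rewrite pevalZ -mulrA; congr (_ * _); rewrite pevalM mlfE mderiv_sum peval_sum.
rewrite mulr_sumr mulr_suml; apply: eq_bigr => A _.
rewrite mderivZ pevalZ mE mderiv_Ymon (shiftXE c h0) pevalZ.
have -> : peval (Yvar c h i) x = y 0 i by rewrite peval_Yvar mxE.
have yp0 s : ypow h s != 0 by apply/prodf_neq0 => k _.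
have -> : ypow h (i |: (tau :\ l))%SET = h 0 i * ypow h (tau :\ l)%SET.
  by rewrite /ypow big_setU1//= !inE negb_and it orbT.
have -> : ypow h tau = h 0 l * ypow h (tau :\ l)%SET by rewrite /ypow (big_setD1 l).
case: (l \in A) => /=; last by rewrite peval0; ring.
by rewrite pevalZ ypE; field; rewrite !h0 yp0.
Qed.

Definition corner V : 'rV[R]_n := \row_i (i \in V)%:R.

Lemma ypow_ind V A : ypow (corner V) A = (A \subset V)%:R.
Proof.
have [AV|/fintype.subsetPn[i iA iV]] := boolP (A \subset V).
  by rewrite /ypow big1// => i iA; rewrite mxE (fintype.subsetP AV).
by rewrite /ypow (bigD1 i)//= mxE (negbTE iV) mul0r.
Qed.

(** Uniqueness in Moebius inversion on the subset lattice: taking V = A leaves [N A] and terms at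
    proper subsets of A. *)
Lemma moebius_eq0 (N : {set 'I_n} -> R) :
  (forall V, \sum_A N A * (A \subset V)%:R = 0) -> forall A, N A = 0.
Proof.
move=> N0 A; have [k] := ubnP #|A|; elim: k A => // k IH A Ak.
have := N0 A; rewrite (bigD1 A)//= fintype.subxx mulr1 big1 ?addr0// => B BA.
have [BsA|_] := boolP (B \subset A); last by rewrite mulr0.
rewrite IH ?mul0r//; rewrite ltnS in Ak; apply: (leq_trans _ Ak); apply: proper_card.
by rewrite finset.properEneq BA.
Qed.

(** At a corner y_i^2 = y_i, so y_i y^(A - l) takes the value of the multilinear monomial of i + (A
    - l) even when i is in A. This is the coefficient of y^B after that reduction, not a coefficient
    of the polynomial [ref] itself. *)
Definition ref_coef a tau B : R :=
  disj_part a tau B + \sum_(l in tau) meet_part a tau B * (1 + (l \in B)%:R) +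
  \sum_(l in tau) \sum_(i | i \notin tau) (wsign R tau l * wsign R (tau :\ l)%SET i) *
    \sum_(A : {set 'I_n} | (l \in A) && ((i |: (A :\ l))%SET == B)) meet_part a (i |: (tau :\ l))%SET A.

Lemma ref_indE a tau V : ref a tau (corner V) = \sum_B ref_coef a tau B * (B \subset V)%:R.
Proof.
rewrite /ref; under [RHS]eq_bigr do rewrite !mulrDl.
rewrite !big_split /=; congr (_ + _ + _).
- by apply: eq_bigr => A _; rewrite ypow_ind.
- rewrite exchange_big; apply: eq_bigr => A _ /=; rewrite mulr_suml.
  by apply: eq_bigr => l _; rewrite ypow_ind.
under [RHS]eq_bigr do rewrite mulr_suml.
rewrite [RHS]exchange_big /=; apply: eq_bigr => l lt.
under [RHS]eq_bigr do rewrite mulr_suml.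
rewrite [RHS]exchange_big /=; apply: eq_bigr => i it.
under [RHS]eq_bigr do rewrite -mulrA.
rewrite -[RHS]mulr_sumr; congr (_ * _).
rewrite (bigID (fun A => l \in A)) /= addrC big1 ?add0r; last first.
  by move=> A /negbTE ->; rewrite mul0r mulr0.
rewrite (partition_big (fun A => i |: (A :\ l))%SET xpredT)//=.
apply: eq_bigr => B _; rewrite mulr_suml; apply: eq_bigr => A /andP[lA /eqP <-].
rewrite lA mul1r ypow_ind mxE; congr (_ * _).
by rewrite finset.subUset finset.sub1set -natrM mulnb.
Qed.

(** The exchange moves l from the form index to the monomial and i the other way, so the level |A
    cap sigma| is preserved: the diagonal blocks of the system are the levels. *)
Lemma swap_meet tau B l i : l \in tau -> l \notin B -> i \notin tau -> i \in B ->
  (l |: (B :\ i))%SET :&: (i |: (tau :\ l))%SET = B :&: tau.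
Proof.
move=> lt lB it iB; have il : i != l by apply: contraNneq it => ->.
apply/finset.setP => k; rewrite !inE.
case: (eqVneq k l) => [->|kl]; first by rewrite (negbTE lB) eq_sym (negbTE il).
by case: (eqVneq k i) => [->|ki] //=; rewrite (negbTE it) andbF.
Qed.

(* With the coefficients of level m = |A cap sigma| alone present above level 0,
   the equations read (2 m + kappa^T kappa) a = 0. *)
Lemma ref_coef_top a tau B : (0 < #|B :&: tau|)%N ->
  (forall s A, (#|B :&: tau| < #|A :&: s|)%N -> a s A = 0) ->
  ref_coef a tau B = (#|tau| + #|B :&: tau|)%:R * a tau B +
    \sum_(l in tau :\: B) \sum_(i in B :\: tau)
      (wsign R tau l * wsign R (tau :\ l)%SET i) *
        a (i |: (tau :\ l))%SET (l |: (B :\ i))%SET.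
Proof.
move=> m0 top; have meetE s A : meet_part a s A = if A :&: s == finset.set0 then 0 else a s A.
  by rewrite /meet_part -finset.disjoints_subset -setI_eq0.
have Bt0 : B :&: tau != finset.set0 by rewrite -card_gt0.
have -> : ref_coef a tau B = \sum_(l in tau) meet_part a tau B * (1 + (l \in B)%:R) +
  \sum_(l in tau) \sum_(i | i \notin tau) (wsign R tau l * wsign R (tau :\ l)%SET i) *
    \sum_(A : {set 'I_n} | (l \in A) && ((i |: (A :\ l))%SET == B)) meet_part a (i |: (tau :\ l))%SET A.
  rewrite /ref_coef {1}/disj_part ifF ?add0r//.
  by apply/negbTE; rewrite -finset.disjoints_subset -setI_eq0.
congr (_ + _).
  rewrite -mulr_sumr meetE (negbTE Bt0) mulrC; congr (_ * _).
  rewrite big_split /= sumr_const natrD; congr (_ + _).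
  rewrite -sum1_card natr_sum [RHS]big_mkcond [LHS]big_mkcond /=.
  by apply: eq_bigr => l _; rewrite inE andbC; case: (l \in tau) => //=; case: ifP.
rewrite (bigID (mem B)) /= big1 ?add0r; last first.
  move=> l /andP[lt lB]; rewrite big1// => i it; rewrite big1 ?mulr0// => A /andP[_ /eqP AB].
  by move: lB it; rewrite -AB !inE eqxx orbF => /eqP <-; rewrite lt.
apply: eq_big => [l|l /andP[lt lB]]; first by rewrite inE andbC.
rewrite (bigID (mem B)) /= addrC big1 ?add0r; last first.
  move=> i /andP[it iB]; rewrite big1 ?mulr0// => A /andP[_ /eqP AB].
  by move: iB; rewrite -AB !inE eqxx.
apply: eq_big => [i|i /andP[it iB]]; first by rewrite inE andbC.
congr (_ * _); rewrite (bigD1 (l |: (B :\ i))%SET) /=; last first.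
  rewrite !inE eqxx /= setU1K ?finset.setD1K//.
  by rewrite !inE negb_and lB orbT.
have inter := swap_meet lt lB it iB.
rewrite meetE inter (negbTE Bt0) big1 ?addr0// => A /andP[/andP[lA /eqP AB] AD].
(* Any other preimage of B contains i, that is A = l + B: this is the collapsed square. Its level is
   one higher, where [a] vanishes by [top]. *)
have iA : i \in A.
  apply: contraNT AD => iA; rewrite -AB setU1K ?finset.setD1K//.
  by rewrite !inE negb_and iA orbT.
rewrite meetE top ?if_same//.
have -> : A :&: (i |: (tau :\ l)) = i |: (B :&: tau).
  apply/finset.setP => k; rewrite -AB !inE.
  by case: (eqVneq k i) => [->|ki] /=; rewrite ?iA// andbCA andbA.
by rewrite cardsU1 inE (negbTE it) andbF.
Qed.

End Generators.

(** * Injectivity of the evaluation at the corners *)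

Section Unisolvence.
Context (R : realType) (n : nat).
Implicit Types (u q b : Defs.form R n) (i l : 'I_n) (sigma tau rho A B C V : {set 'I_n})
  (c h x y : 'rV[R]_n) (j m : nat) (a f : {set 'I_n} -> {set 'I_n} -> R).

(** Summation by parts: moving l from C into the form index turns the squared norm of kappa f into
    the pairing of f with kappa^T kappa f. *)
Lemma reindex_swap (F : {set 'I_n} -> {set 'I_n} -> 'I_n -> R) :
  \sum_rho \sum_C \sum_(l in C :\: rho) F rho C l =
  \sum_tau \sum_B \sum_(l in tau :\: B) F (tau :\ l)%SET (l |: B)%SET l.
Proof.
transitivity (\sum_(l : 'I_n) \sum_(rho : {set 'I_n} | l \notin rho) \sum_(C : {set 'I_n} | l \in C) F rho C l).
  rewrite [RHS](exchange_big_dep xpredT) //=; apply: eq_bigr => rho _.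
  rewrite [RHS](exchange_big_dep xpredT) //=; apply: eq_bigr => C _.
  by apply: eq_bigl => l; rewrite inE.
transitivity (\sum_(l : 'I_n) \sum_(tau : {set 'I_n} | l \in tau) \sum_(B : {set 'I_n} | l \notin B)
    F (tau :\ l)%SET (l |: B)%SET l); last first.
  rewrite [LHS](exchange_big_dep xpredT) //=; apply: eq_bigr => rho _.
  rewrite [LHS](exchange_big_dep xpredT) //=; apply: eq_bigr => C _.
  by apply: eq_bigl => l; rewrite inE andbC.
apply: eq_bigr => l _.
rewrite (reindex_onto (fun X => X :\ l)%SET (fun X => l |: X)%SET) /=; last first.
  by move=> X lX; rewrite setU1K.
apply: eq_big => [X|X _].
  rewrite !inE eqxx /=; apply/eqP/idP => [<-|/finset.setD1K//]; exact: setU11.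
rewrite (reindex_onto (fun X => l |: X)%SET (fun X => X :\ l)%SET) /=; last first.
  by move=> Y lY; rewrite finset.setD1K.
apply: eq_bigl => Y; rewrite setU11 /=; apply/eqP/idP => [<-|/setU1K//].
by rewrite !inE eqxx.
Qed.

(** Here [f] is the level-m part of [a] and [k] is kappa f with the squares y_i^2 dropped. By parts,
    the sum of [k ^+ 2] is that of f times (|tau - B| f + exchange terms), and the equation replaces
    the exchange terms by -(|tau| + m) f. As |tau| = |tau - B| + m at level m, there remains -2 m
    times the sum of [f ^+ 2], so f = 0. *)
Lemma level_eq0 a m : (0 < m)%N -> (forall tau B, ref_coef a tau B = 0) ->
  (forall s A, (m < #|A :&: s|)%N -> a s A = 0) ->
  forall s A, #|A :&: s| = m -> a s A = 0.
Proof.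
move=> m0 coef0 top.
pose f s A := if #|A :&: s| == m then a s A else 0.
pose k rho C := \sum_(i in C :\: rho) wsign R rho i * f (i |: rho)%SET (C :\ i)%SET.
have energy : \sum_rho \sum_C k rho C ^+ 2 = - (2 * m%:R) * \sum_tau \sum_B f tau B ^+ 2.
  transitivity (\sum_rho \sum_C \sum_(l in C :\: rho)
      (wsign R rho l * f (l |: rho)%SET (C :\ l)%SET) * k rho C).
    by apply: eq_bigr => rho _; apply: eq_bigr => C _; rewrite expr2 {1}/k mulr_suml.
  rewrite reindex_swap mulr_sumr; apply: eq_bigr => tau _.
  rewrite mulr_sumr; apply: eq_bigr => B _.
  transitivity (\sum_(l in tau :\: B) f tau B * (f tau B + \sum_(i in B :\: tau)
      (wsign R tau l * wsign R (tau :\ l)%SET i) * f (i |: (tau :\ l))%SET (l |: (B :\ i))%SET)).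
    apply: eq_bigr => l; rewrite inE => /andP[lB lt].
    rewrite finset.setD1K// setU1K// [wsign R _ l * _]mulrC -mulrA; congr (_ * _).
    rewrite /k (bigD1 l) /=; last by rewrite !inE eqxx.
    rewrite finset.setD1K// setU1K// mulrDr mulrA wsign_sq mul1r; congr (_ + _).
    rewrite mulr_sumr wsign_setD1_id; apply: eq_big => [i|i].
      rewrite !inE; case: (eqVneq i l) => [->|il] /=; last by rewrite andbT.
      by rewrite (negbTE lB) andbF.
    rewrite !inE => /andP[_ il]; rewrite mulrA; congr (_ * f _ _).
    apply/finset.setP => z; rewrite !inE; case: (eqVneq z l) => //= ->.
    by rewrite eq_sym il.
  have [Bm|Bm] := boolP (#|B :&: tau| == m); last first.
    have -> : f tau B = 0 by rewrite /f (negbTE Bm).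
    by rewrite big1 ?expr0n ?mulr0// => l _; rewrite mul0r.
  have fa : f tau B = a tau B by rewrite /f Bm.
  rewrite -mulr_sumr big_split /= sumr_const.
  have := coef0 tau B; rewrite ref_coef_top (eqP Bm)// => /eqP.
  rewrite addr_eq0 => /eqP eq.
  have -> : \sum_(l in tau :\: B) \sum_(i in B :\: tau)
      (wsign R tau l * wsign R (tau :\ l)%SET i) * f (i |: (tau :\ l))%SET (l |: (B :\ i))%SET
    = - ((#|tau| + m)%:R * a tau B).
    rewrite eq opprK; apply: eq_bigr => l; rewrite inE => /andP[lB lt].
    apply: eq_bigr => i; rewrite inE => /andP[it iB].
    by rewrite /f swap_meet// Bm.
  have -> : #|tau| = (#|tau :\: B| + m)%N.
    by rewrite -(cardsID B tau) finset.setIC (eqP Bm) addnC.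
  by rewrite fa -[a tau B *+ _]mulr_natl !natrD; ring.
have sumf0 : \sum_tau \sum_B f tau B ^+ 2 = 0.
  apply/eqP; rewrite eq_le; apply/andP; split; last first.
    by apply: sumr_ge0 => tau _; apply: sumr_ge0 => B _; exact: sqr_ge0.
  have : 0 <= \sum_rho \sum_C k rho C ^+ 2.
    by apply: sumr_ge0 => tau _; apply: sumr_ge0 => B _; exact: sqr_ge0.
  by rewrite energy mulNr oppr_ge0 pmulr_rle0// mulr_gt0// ltr0n.
move=> s A sm; have -> : a s A = f s A by rewrite /f sm eqxx.
apply/eqP; rewrite -sqrf_eq0; apply/eqP.
have sq0 t : 0 <= \sum_B f t B ^+ 2 by apply: sumr_ge0 => B _; exact: sqr_ge0.
have sumfs : \sum_B f s B ^+ 2 = 0.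
  exact: (psumr_eq0P (fun t _ => sq0 t) sumf0 (i := s)).
exact: (psumr_eq0P (fun B _ => sqr_ge0 (f s B)) sumfs (i := A)).
Qed.

(** Descending induction on the level, since no level exceeds n. Once the positive levels vanish,
    [ref_coef a s A] with A disjoint from s is [a s A] itself. *)
Lemma ref_inj a : (forall tau V, ref a tau (corner R V) = 0) -> forall s A, a s A = 0.
Proof.
move=> ref0.
have coef0 tau B : ref_coef a tau B = 0.
  by apply: (moebius_eq0 (N := ref_coef a tau)) => V; rewrite -ref_indE.
have top m s A : (n - m < #|A :&: s|)%N -> a s A = 0.
  elim: m s A => [|m IH] s A.
    by rewrite subn0 ltnNge -[X in (_ <= X)%N](card_ord n) max_card.
  move=> hm; have [|h2] := ltnP (n - m) #|A :&: s|; first exact: IH.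
  apply: (level_eq0 (m := n - m)) => //; last by lia.
  lia.
move=> s A; have := coef0 s A; rewrite /ref_coef.
have meet0 t B : meet_part a t B = 0.
  rewrite /meet_part; case: ifPn => // h1; apply: (top n); rewrite subnn card_gt0.
  by rewrite finset.setI_eq0 finset.disjoints_subset.
have [As|As] := boolP (A \subset ~: s)%SET; last first.
  by move=> _; have := meet0 s A; rewrite /meet_part (negbTE As).
rewrite {1}/disj_part As big1 ?addr0; last by move=> l _; rewrite meet0 mul0r.
by rewrite big1 ?addr0// => l _; rewrite big1// => i _; rewrite big1 ?mulr0.
Qed.

End Unisolvence.

(** * Interpolation at the vertices of a box, with bounds *)

Section Interpolation.
Context (R : realType) (n : nat).
Implicit Types (u : Defs.form R n) (i l : 'I_n) (sigma tau A B V s : {set 'I_n})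
  (c h x y : 'rV[R]_n) (j : nat) (a v : {set 'I_n} -> {set 'I_n} -> R) (T : box R n).
Local Notation I := ({set 'I_n} * {set 'I_n})%type.

Lemma ref_linear (r : R) a a' tau y :
  ref (fun s A => r * a s A + a' s A) tau y = r * ref a tau y + ref a' tau y.
Proof.
have dE s A : disj_part (fun s A => r * a s A + a' s A) s A =
    r * disj_part a s A + disj_part a' s A.
  by rewrite /disj_part; case: ifP => // _; rewrite mulr0 addr0.
have mE s A : meet_part (fun s A => r * a s A + a' s A) s A =
    r * meet_part a s A + meet_part a' s A.
  by rewrite /meet_part; case: ifP => // _; rewrite mulr0 addr0.
rewrite /ref !mulrDr [RHS]addrACA [X in _ = X + _]addrACA; congr (_ + _ + _).
- by rewrite mulr_sumr -big_split; apply: eq_bigr => A _ /=; rewrite dE; ring.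
- rewrite mulr_sumr -big_split; apply: eq_bigr => l _ /=.
  by rewrite mulr_sumr -big_split; apply: eq_bigr => A _ /=; rewrite mE; ring.
- rewrite mulr_sumr -big_split; apply: eq_bigr => l _ /=.
  rewrite mulr_sumr -big_split; apply: eq_bigr => i _ /=.
  rewrite mulrCA -mulrDr; congr (_ * _).
  by rewrite mulr_sumr -big_split; apply: eq_bigr => A _ /=; rewrite mE; ring.
Qed.

Lemma ref0 tau y : ref (fun _ _ => 0) tau y = 0.
Proof.
have := ref_linear 1 (fun _ _ => 0) (fun _ _ => 0) tau y.
under eq_fun do under eq_fun do rewrite mulr0 addr0.
by rewrite mul1r => h; lra.
Qed.

Definition delta (t : I) sigma A : R := (t == (sigma, A))%:R.

Lemma ref_delta a tau y : ref a tau y = \sum_(t : I) a t.1 t.2 * ref (delta t) tau y.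
Proof.
have {1}-> : a = fun s A => \sum_(t : I) a t.1 t.2 * delta t s A.
  apply/funext => s; apply/funext => A; rewrite (bigD1 (s, A))//= /delta eqxx mulr1.
  by rewrite big1 ?addr0// => t /negbTE ->; rewrite mulr0.
elim: (index_enum _) => [|t r IH].
  by rewrite big_nil; under eq_fun do under eq_fun do rewrite big_nil; exact: ref0.
rewrite big_cons -IH -ref_linear; congr (ref _ tau y).
by apply/funext => s; apply/funext => A; rewrite big_cons.
Qed.

Lemma norm_sum_le (J : finType) (P : pred J) (F : J -> R) (C : R) : 0 <= C ->
  (forall k, P k -> `|F k| <= C) -> `|\sum_(k | P k) F k| <= #|J|%:R * C.
Proof.
move=> C0 FC; apply: (le_trans (ler_norm_sum _ _ _)).
rewrite big_mkcond /= mulr_natl -sumr_const; apply: ler_sum => k _.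
by case: ifP => // /FC.
Qed.

Lemma ypow_bounded y A : (forall i, 0 <= y 0 i <= 1) -> 0 <= ypow y A <= 1.
Proof.
move=> y01; apply/andP; split.
  by apply: prodr_ge0 => i _; case/andP: (y01 i).
by apply: prodr_ile1 => i _; exact: y01.
Qed.

Definition sum_norm a : R := \sum_(t : I) `|a t.1 t.2|.

Lemma sum_norm_ge0 a : 0 <= sum_norm a.
Proof. by apply: sumr_ge0 => t _. Qed.

Lemma le_sum_norm a sigma A : `|a sigma A| <= sum_norm a.
Proof.
rewrite /sum_norm (bigD1 (sigma, A))//= lerDl.
by apply: sumr_ge0 => t _.
Qed.

Lemma ref_bounded : exists2 K : R, 0 <= K & forall a tau y,
  (forall i, 0 <= y 0 i <= 1) -> `|ref a tau y| <= K * sum_norm a.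
Proof.
pose N : R := #|{set 'I_n}|%:R; pose m : R := #|'I_n|%:R.
exists (N + m * (N * 2) + m * (m * N)).
  by rewrite !addr_ge0// !mulr_ge0// ler0n.
move=> a tau y y01; set S := sum_norm a.
have S0 : 0 <= S := sum_norm_ge0 a.
have dS s A : `|disj_part a s A| <= S.
  by rewrite /disj_part; case: ifP; rewrite ?normr0// le_sum_norm.
have mS s A : `|meet_part a s A| <= S.
  by rewrite /meet_part; case: ifP; rewrite ?normr0// le_sum_norm.
have y1 A : `|ypow y A| <= 1.
  by have /andP[h0 h1] := ypow_bounded A y01; rewrite ger0_norm.
rewrite !mulrDl; apply: (le_trans (ler_normD _ _)); apply: lerD.
  apply: (le_trans (ler_normD _ _)); apply: lerD.
    apply: norm_sum_le => // A _; rewrite normrM -[leRHS]mulr1.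
    exact: ler_pM.
  rewrite -!mulrA; apply: norm_sum_le => [|l _]; first by rewrite !mulr_ge0// ler0n.
  apply: norm_sum_le => [|A _]; first by rewrite mulr_ge0.
  rewrite !normrM -[leRHS]mulr1 [2 * S]mulrC; apply: ler_pM; rewrite ?mulr_ge0//.
  by apply: ler_pM => //; rewrite ger0_norm ?addr_ge0 ?ler0n//; case: (l \in A) => /=; rewrite ?addr0 ?ler1n.
rewrite -!mulrA; apply: norm_sum_le => [|l _]; first by rewrite !mulr_ge0// ler0n.
apply: norm_sum_le => [|i _]; first by rewrite !mulr_ge0// ler0n.
rewrite !normrM /wsign !normrX !normrN1 !expr1n !mul1r.
apply: norm_sum_le => // A _; rewrite normrM -[leRHS]mulr1; apply: ler_pM => //.
rewrite normrM -[leRHS]mulr1; apply: ler_pM => //.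
  by case: (l \in A); rewrite /= ?normr1 ?normr0.
rewrite normrM -[leRHS]mulr1; apply: ler_pM => //.
by have /andP[h0 h1] := y01 i; rewrite ger0_norm.
Qed.

(** Forms of all degrees are treated together, so that unknowns and equations are both indexed by
    pairs of subsets and the matrix is square. It is invertible by [ref_inj], and [K], the sum of
    the moduli of the entries of its inverse, depends on n only. *)
Lemma ref_solve : exists2 K : R, 0 <= K & forall v, exists2 a,
  forall tau V, ref a tau (corner R V) = v tau V & forall sigma A, `|a sigma A| <= K * sum_norm v.
Proof.
pose N := #|{: I}|.
pose M : 'M[R]_N := \matrix_(p, k) ref (delta (enum_val p)) (enum_val k).1 (corner R (enum_val k).2).
pose vec v : 'rV[R]_N := \row_k v (enum_val k).1 (enum_val k).2.
pose fn (w : 'rV[R]_N) sigma A := w 0 (enum_rank (sigma, A)).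
have mulM w tau V : ref (fn w) tau (corner R V) = fn (w *m M) tau V.
  rewrite ref_delta /fn mxE (reindex (fun k : 'I_N => enum_val k)) /=; last first.
    by exists enum_rank => k _; rewrite ?enum_valK ?enum_rankK.
  apply: eq_bigr => k _; rewrite mxE enum_rankK /=.
  by rewrite -surjective_pairing enum_valK.
have M0 (w : 'rV[R]_N) : w *m M = 0 -> w = 0.
  move=> wM; have fn0 : forall s A, fn w s A = 0.
    by apply: ref_inj => tau V; rewrite mulM wM /fn mxE.
  apply/rowP => k; rewrite mxE -(enum_valK k).
  by rewrite [enum_val k]surjective_pairing; exact: fn0.
have Mu : M \in unitmx.
  rewrite -row_free_unit -kermx_eq0; apply/eqP/row_matrixP => k.
  by rewrite row0; apply: M0; rewrite -row_mul mulmx_ker row0.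
pose K := \sum_p \sum_k `|invmx M p k|.
have K0 : 0 <= K by apply: sumr_ge0 => p _; apply: sumr_ge0.
have MK p k : `|invmx M p k| <= K.
  rewrite /K (bigD1 p)//= (bigD1 k)//= -addrA lerDl addr_ge0//; apply: sumr_ge0 => // q _.
  exact: sumr_ge0.
exists K => // v; exists (fn (vec v *m invmx M)).
  by move=> tau V; rewrite mulM mulmxKV// /fn mxE enum_rankK.
move=> sigma A; rewrite /fn mxE; apply: (le_trans (ler_norm_sum _ _ _)).
rewrite /sum_norm mulr_sumr [leRHS](reindex (fun k : 'I_N => enum_val k)) /=; last first.
  by exists enum_rank => k _; rewrite ?enum_valK ?enum_rankK.
by apply: ler_sum => k _; rewrite normrM mxE mulrC ler_wpM2r.
Qed.

(** An exchange keeps the cardinality of the form index, so the system decouples by degree. *)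
Lemma ref_local a a' tau y : (forall s A, #|s| = #|tau| -> a s A = a' s A) ->
  ref a tau y = ref a' tau y.
Proof.
move=> aa; have dE s A : #|s| = #|tau| -> disj_part a s A = disj_part a' s A.
  by move=> st; rewrite /disj_part aa.
have mE s A : #|s| = #|tau| -> meet_part a s A = meet_part a' s A.
  by move=> st; rewrite /meet_part aa.
rewrite /ref; congr (_ + _ + _).
- by apply: eq_bigr => A _; rewrite dE.
- by apply: eq_bigr => l _; apply: eq_bigr => A _; rewrite mE.
- apply: eq_bigr => l lt; apply: eq_bigr => i it; congr (_ * _).
  apply: eq_bigr => A _; rewrite mE// cardsU1 !inE negb_and it orbT /=.
  by rewrite [in RHS](cardsD1 l) lt.
Qed.

Lemma ref_form0 j a tau y : (forall s A, #|s| <> j -> a s A = 0) -> #|tau| <> j ->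
  ref a tau y = 0.
Proof.
by move=> aj tj; rewrite -(ref0 tau y); apply: ref_local => s A st; rewrite aj// st.
Qed.

Definition edges T : 'rV[R]_n := T.2 - T.1.

Definition coords T x : 'rV[R]_n := \row_i ((x 0 i - T.1 0 i) / edges T 0 i).

Lemma edges_gt0 T i : Defs.nondegenerate T -> 0 < edges T 0 i.
Proof. by move=> nT; rewrite !mxE subr_gt0. Qed.

Lemma edges_neq0 T i : Defs.nondegenerate T -> edges T 0 i != 0.
Proof. by move=> nT; rewrite gt_eqF// edges_gt0. Qed.

Lemma coords_vertex T V : Defs.nondegenerate T -> coords T (vertex T V) = corner R V.
Proof.
move=> nT; apply/rowP => i; rewrite !mxE; case: ifP => _ /=; last by rewrite subrr mul0r.
by rewrite divff// subr_eq0 gt_eqF.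
Qed.

Lemma coords_box T x : Defs.nondegenerate T -> box_set T x -> forall i, 0 <= coords T x 0 i <= 1.
Proof.
move=> nT Tx i; rewrite mxE; have /andP[h1 h2] := Tx i.
have e0 := edges_gt0 i nT.
rewrite divr_ge0 ?subr_ge0 ?(ltW e0)//= ler_pdivrMr// mul1r.
by rewrite !mxE lerD2r.
Qed.

Lemma ypow_edges_gt0 T A : Defs.nondegenerate T -> 0 < ypow (edges T) A.
Proof. by move=> nT; apply: prodr_gt0 => i _; exact: edges_gt0. Qed.

Lemma S1p_ref j T u : Defs.nondegenerate T -> S1p j u -> exists2 a,
  forall s A, #|s| <> j -> a s A = 0 &
  forall tau x, peval (u tau) x = ref a tau (coords T x) / ypow (edges T) tau.
Proof.
move=> nT; have e0 i := edges_neq0 i nT.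
move=> /(S1p_gen T.1 j _ e0)[a [aj ->]].
pose a' s A := a s A * ypow (edges T) s.
have aE : a = fun s A => a' s A / ypow (edges T) s.
  by apply/funext => s; apply/funext => A; rewrite /a' mulfK// gt_eqF// ypow_edges_gt0.
exists a'; first by move=> s A /aj a0; rewrite /a' a0 mul0r.
move=> tau x; rewrite aE; exact: gen_ref.
Qed.

Lemma S1p_interp j T v : Defs.nondegenerate T -> (forall s A, #|s| <> j -> v s A = 0) ->
  exists2 u, S1p j u & forall sigma V, peval (u sigma) (vertex T V) = v sigma V.
Proof.
move=> nT vj; have e0 i := edges_neq0 i nT.
have [_ _ /(_ (fun s A => v s A * ypow (edges T) s))[a ha _]] := ref_solve.
pose a' s A := if #|s| == j then a s A else 0.
exists (gen T.1 (edges T) (fun s A => a' s A / ypow (edges T) s)).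
  apply/(S1p_gen T.1 _ _ e0); exists (fun s A => a' s A / ypow (edges T) s); split=> //.
  by move=> s A /eqP/negbTE sj; rewrite /a' sj mul0r.
move=> tau V; rewrite gen_ref// -/(coords T _) coords_vertex//.
have [tj|/eqP tj] := eqVneq #|tau| j; last first.
  by rewrite (@ref_form0 j) ?mul0r ?vj// => s A /eqP/negbTE sj; rewrite /a' sj.
rewrite (@ref_local _ a); last by move=> s A st; rewrite /a' st tj eqxx.
by rewrite ha mulfK// gt_eqF// ypow_edges_gt0.
Qed.

Lemma S1p_vertex_inj j T u : Defs.nondegenerate T -> S1p j u ->
  (forall sigma V, peval (u sigma) (vertex T V) = 0) -> u = 0.
Proof.
move=> nT Su u0; have e0 i := edges_neq0 i nT.
have [a [aj uE]] := (S1p_gen T.1 j u e0).1 Su.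
pose a' s A := a s A * ypow (edges T) s.
have aE : a = fun s A => a' s A / ypow (edges T) s.
  by apply/funext => s; apply/funext => A; rewrite /a' mulfK// gt_eqF// ypow_edges_gt0.
have a'0 : forall s A, a' s A = 0.
  apply: ref_inj => tau V; have /eqP := u0 tau V; rewrite uE aE gen_ref//.
  rewrite -/(coords T _) coords_vertex// mulf_eq0 invr_eq0.
  by rewrite (gt_eqF (ypow_edges_gt0 _ _))// orbF => /eqP.
have mlf0 e : (forall s A, e s A = 0) -> mlf T.1 (edges T) e = 0.
  by move=> e0'; apply/ffunP => s; rewrite mlfE ffunE big1// => A _; rewrite e0' scale0r.
rewrite uE aE /gen !mlf0 ?add0r.
- exact: dext_koszul_at_0.
- by move=> s A; rewrite /meet_part a'0 mul0r if_same.
- by move=> s A; rewrite /disj_part a'0 mul0r if_same.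
Qed.

(** In reference coordinates the vertex values of u_s are multiplied by h^s and the result is
    divided by h^tau. Both are products of j edge lengths lying between r and gamma r, so their
    quotient is at most gamma^j. *)
Lemma S1p_bound j (gamma : R) : 0 <= gamma -> exists2 K : R, 0 <= K &
  forall T (r : R), Defs.nondegenerate T -> 0 < r ->
    (forall i, r <= edges T 0 i <= gamma * r) ->
  forall u, S1p j u -> forall x tau, box_set T x ->
    `|peval (u tau) x| <= K * \sum_(t : I) `|peval (u t.1) (vertex T t.2)|.
Proof.
move=> g0; have [K1 K10 hK1] := ref_bounded; have [K2 K20 hK2] := ref_solve.
exists (K1 * (#|{: I}|%:R * (K2 * gamma ^+ j))).
  by rewrite !mulr_ge0// exprn_ge0.
move=> T r nT r0 Tr u Su x tau Tx.
have [a aj ua] := S1p_ref nT Su.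
have P0 A := ypow_edges_gt0 A nT.
have [tj|/eqP tj] := eqVneq #|tau| j; last first.
  rewrite ua (ref_form0 _ aj)// mul0r normr0 !mulr_ge0 ?exprn_ge0//.
  exact: sumr_ge0.
pose v s A := peval (u s) (vertex T A) * ypow (edges T) s.
have vj s A : #|s| <> j -> v s A = 0.
  by move=> sj; rewrite /v ua (ref_form0 _ aj)// !mul0r.
have [b hb bK] := hK2 v.
have ab s A : a s A = b s A.
  have := @ref_inj _ _ (fun s A => -1 * b s A + a s A) _ s A.
  rewrite mulN1r addrC => /(_ _)/subr0_eq; apply => t V.
  by rewrite ref_linear hb /v ua coords_vertex// divfK ?gt_eqF// mulN1r addNr.
rewrite ua normrM normfV (gtr0_norm (P0 _)) ler_pdivrMr//.
apply: (le_trans (hK1 _ _ _ (coords_box nT Tx))).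
rewrite -!mulrA; apply: ler_wpM2l => //.
have -> : sum_norm a = sum_norm b by apply: eq_bigr => t _; rewrite ab.
apply: (@le_trans _ _ (\sum_(t : I) K2 * sum_norm v)); first exact: ler_sum.
rewrite sumr_const -[leLHS]mulr_natl. apply: ler_wpM2l => //. apply: ler_wpM2l => //.
rewrite [X in _ * X]mulrC mulrA mulr_sumr; apply: ler_sum => t _; rewrite /v normrM.
have [sj|/eqP sj] := eqVneq #|t.1| j; last first.
  rewrite ua (ref_form0 _ aj)// mul0r normr0 mul0r.
  by rewrite !mulr_ge0 ?exprn_ge0// ltW.
rewrite [leLHS]mulrC (gtr0_norm (P0 _)); apply: ler_wpM2r => //.
apply: (@le_trans _ _ ((gamma * r) ^+ j)).
  rewrite -sj -prodr_const; apply: ler_prod => i _.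
  by have /andP[h1 ->] := Tr i; rewrite (le_trans (ltW r0)).
rewrite exprMn; apply: ler_wpM2l; first exact: exprn_ge0.
rewrite -tj -prodr_const; apply: ler_prod => i _.
by have /andP[-> _] := Tr i; rewrite ltW.
Qed.

End Interpolation.

(** * Traces on faces and single-valued degrees of freedom *)

Section Faces.
Context (R : realType) (n : nat).
Implicit Types (p q v : mpoly n R) (u w : Defs.form R n) (i l : 'I_n)
  (sigma tau A B S s : {set 'I_n}) (x : 'rV[R]_n) (j : nat) (f T : box R n).

Lemma S1pD j u w : S1p j u -> S1p j w -> S1p j (u + w).
Proof. by move=> /(S1pP 0) hu /(S1pP 0) hw; apply/(S1pP 0); exact: S1p_atD. Qed.

Lemma S1pZ j (a : R) u : S1p j u -> S1p j (a *: u).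
Proof. by move=> /(S1pP 0) hu; apply/(S1pP 0); exact: S1p_atZ. Qed.

Lemma S1p_0 j : S1p j (0 : Defs.form R n).
Proof.
apply/(S1pP 0); exists 0, 0; split.
- by split=> [s _|s _]; rewrite ffunE//; exact: Q1_0.
- by split=> s *; rewrite ffunE//; exact: Q1_0.
- by rewrite dext_koszul_at_0 addr0.
Qed.

Lemma Q1m_S1p j u : Q1m j u -> S1p j u.
Proof.
move=> hu; apply/(S1pP 0); exists u, 0; split=> //.
  by split=> s *; rewrite ffunE//; exact: Q1_0.
by rewrite dext_koszul_at_0 addr0.
Qed.

Lemma S1p_is_form j u : S1p j u -> is_form j u.
Proof.
move=> /(S1pP 0)[q [b [/Q1mP[jq _] [jb _] ->]]].
by apply: is_formD => //; exact: is_form_dext_koszul_at.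
Qed.

(** The operators (x_l - c_l) d_l preserve degrees, and an exchange term multiplies only by a
    variable x_k with k outside tau. Hence u_tau is at most affine along tau and may be quadratic
    across it. *)
Lemma S1p_dle j u tau i : S1p j u -> dle i (2 - (i \in tau)) (u tau).
Proof.
move=> /(S1pP 0)[q [b [/Q1mP[_ hq] [_ hb] ->]]].
have d1 : (1 <= 2 - (i \in tau))%N by case: (_ \in _).
have db s k : dle k 1 (b s) by have /Q1P/(_ k) := hb s; rewrite inE.
rewrite formDE dext_koszul_at; apply: dleD.
  by have /Q1P/(_ i) := hq tau; apply: dleW; apply: leq_trans d1; exact: leq_b1.
apply: dleD; apply: dle_sum => l lt.
  apply: dleD; first exact: dleW (db _ _).
  have [<-|il] := eqVneq i l.
    by apply: dleW (dleM (@dle_shiftX _ _ 0 i i) (dle_mderivS (db tau i))); rewrite eqxx.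
  apply: dleW (dleM (@dle_shiftX _ _ 0 i l) (dle_mderiv (l := l) (db tau i))).
  by rewrite (negbTE il).
apply: dle_sum => k kt; apply: dleZ.
apply: dleW (dleM (@dle_shiftX _ _ 0 i k) (dle_mderiv (l := l) (db _ i))).
by case: eqVneq => [->|_]; rewrite ?(negbTE kt).
Qed.

Lemma S1p_dle2 j u tau i : S1p j u -> dle i 2 (u tau).
Proof. by move=> hu; apply: dleW (S1p_dle i hu); rewrite leq_subr. Qed.

Lemma S1p_dle1 j u tau i : S1p j u -> i \in tau -> dle i 1 (u tau).
Proof. by move=> hu it; have := @S1p_dle _ u tau i hu; rewrite it. Qed.

Lemma face_fst T sigma A i : (face T sigma A).1 0 i =
  if i \in sigma then T.1 0 i else vertex T A 0 i.
Proof. by rewrite mxE. Qed.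

Lemma face_snd T sigma A i : (face T sigma A).2 0 i =
  if i \in sigma then T.2 0 i else vertex T A 0 i.
Proof. by rewrite mxE. Qed.

Lemma dirs_face T sigma A : Defs.nondegenerate T -> dirs (face T sigma A) = sigma.
Proof.
move=> nT; apply/finset.setP => i; rewrite dirsP face_fst face_snd.
by case: ifP => _; [exact: nT|exact: ltxx].
Qed.

Lemma proper_face T sigma A : Defs.nondegenerate T -> proper (face T sigma A).
Proof. by move=> nT i; rewrite face_fst face_snd; case: ifP => // _; exact/ltW. Qed.

Definition glue sigma A B := ((A :\: sigma) :|: (B :&: sigma))%SET.

Lemma in_glue sigma A B i : (i \in glue sigma A B) = if i \in sigma then i \in B else i \in A.
Proof. by rewrite !inE; case: (i \in sigma); rewrite ?andbT ?andbF ?orbF. Qed.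

Lemma vertex_face T sigma A B : vertex (face T sigma A) B = vertex T (glue sigma A B).
Proof.
apply/rowP => i; rewrite [LHS]mxE face_fst face_snd [in RHS]mxE in_glue.
by case: (i \in sigma) => //; rewrite if_same mxE.
Qed.

Lemma dirs_nondegenerate T : Defs.nondegenerate T -> dirs T = [set: 'I_n]%SET.
Proof. by move=> nT; apply/finset.setP => i; rewrite dirsP inE nT. Qed.

Lemma proper_nondegenerate T : Defs.nondegenerate T -> proper T.
Proof. by move=> nT i; exact/ltW. Qed.

Lemma face_int_tr f u : face_int f (tr f u) = box_int f (peval (u (dirs f))).
Proof. by rewrite /face_int ffunE fintype.subxx. Qed.

Lemma face_int_wedge0 f u v :
  face_int f (wedge0 (tr f u) v) = box_int f (peval (u (dirs f) * v)).
Proof. by rewrite /face_int ffunE ffunE fintype.subxx. Qed.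

Lemma dle_prod (I : finType) (F : I -> mpoly n R) (d : I -> nat) (k : 'I_n) :
  (forall z, dle k (d z) (F z)) -> dle k (\sum_z d z) (\prod_z F z).
Proof.
move=> h; apply: (big_ind2 (fun e p => dle k e p)) => //.
  by rewrite -mpolyC1; exact: dleC.
by move=> d1 p1 d2 p2; exact: dleM.
Qed.

(** Tensor products of the affine functions Y_i and 1 - Y_i, i in S, form the Lagrange basis. Since
    no other variable occurs, the prescribed values can depend on B cap S only. *)
Lemma Q1_interp f S (g : {set 'I_n} -> R) : S \subset dirs f ->
  exists2 p, Q1 S p & forall B, peval p (vertex f B) = g (B :&: S)%SET.
Proof.
move=> Sf; pose Y i : mpoly n R := Yvar f.1 (edges f) i.
have Y01 i B : i \in S -> peval (Y i) (vertex f B) = (i \in B)%:R.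
  move=> /(fintype.subsetP Sf); rewrite dirsP => fi.
  rewrite peval_Yvar !mxE; case: ifP => _; last by rewrite subrr mul0r.
  by rewrite divff// subr_eq0 gt_eqF.
pose L A i : mpoly n R := if i \in S then (if i \in A then Y i else 1 - Y i) else 1.
pose lag A := \prod_i L A i.
have lagE A B : A \subset S -> peval (lag A) (vertex f B) = (A == (B :&: S)%SET)%:R.
  move=> AS; rewrite /lag peval_prod; case: eqP => [->|/eqP AB].
    rewrite big1// => i _; rewrite /L inE; case: ifPn => iS; last by rewrite peval1.
    rewrite iS andbT; case: ifPn => iB; first by rewrite Y01// iB.
    by rewrite pevalB peval1 Y01// (negbTE iB) subr0.
  have [i iAB] : exists i, (i \in A) != (i \in (B :&: S)%SET).
    apply/existsP; apply: contra_neqT AB; rewrite negb_exists => /forallP h.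
    by apply/finset.setP => i; apply/eqP; move: (h i); rewrite negbK.
  rewrite (bigD1 i)//= /L; move: iAB; rewrite inE; case: ifPn => iS.
    rewrite ?iS andbT; case: ifP => iA.
      by rewrite Y01//; case: (i \in B) => // _; rewrite mul0r.
    by rewrite pevalB peval1 Y01//; case: (i \in B) => // _; rewrite subrr mul0r.
  by rewrite ?(negbTE iS) ?andbF; case: (boolP (i \in A)) => // /(fintype.subsetP AS); rewrite (negbTE iS).
exists (\sum_(A : {set 'I_n} | A \subset S) g A *: lag A).
  apply: Q1_sum => A _; apply: Q1Z; apply/Q1P => k.
  apply: (@dleW _ _ _ (\sum_i ((k == i) && (i \in S)))).
    rewrite (bigD1 k)//= eqxx big1 ?addn0// => i ik.
    by rewrite eq_sym (negbTE ik).
  apply: dle_prod => i; rewrite /L; case: ifP => _; last first.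
    by rewrite -mpolyC1; apply: (@dleW _ _ _ 0) => //; exact: dleC.
  rewrite andbT; case: ifP => _; first exact: dle_Yvar.
  apply: dleB; last exact: dle_Yvar.
  by rewrite -mpolyC1; apply: (@dleW _ _ _ 0) => //; exact: dleC.
move=> B; rewrite peval_sum (bigD1 (B :&: S)%SET) ?finset.subsetIr//=.
rewrite pevalZ lagE ?finset.subsetIr// eqxx mulr1 big1 ?addr0// => A /andP[AS AB].
by rewrite pevalZ lagE// (negbTE AB) mulr0.
Qed.

Lemma deg1_mix_eq0 f (r : seq 'I_n) p x : uniq r ->
  (forall i, i \in r -> dle i 1 p /\ f.1 0 i < f.2 0 i) ->
  (forall B, peval p (mix r B f x) = 0) -> peval p x = 0.
Proof.
elim: r => [|i r IH] /=.
  by move=> _ _ /(_ finset.set0) <-; congr peval; apply/rowP => l; rewrite mxE.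
move=> /andP[ir ur] hr p0; apply: IH => // [l lr|B].
  by apply: hr; rewrite inE lr orbT.
have [p1 fi] := hr i (mem_head _ _).
rewrite -(upd_id x i) mix_upd// (peval_deg1 _ _ p1 (negbT (lt_eqF fi))).
have := p0 (i |: B)%SET; have := p0 (B :\ i)%SET.
rewrite !mix_cons mix_setU1// mix_setD1// !mxE !inE eqxx /= => -> ->.
by rewrite !mulr0 addr0 mul0r.
Qed.

Lemma deg1_box_eq0 f p x : (forall i, i \in dirs f -> dle i 1 p) ->
  (forall B, peval p (vertex f B) = 0) -> box_set f x -> peval p x = 0.
Proof.
move=> p1 p0 fx; apply: (@deg1_mix_eq0 f (enum (dirs f))); rewrite ?enum_uniq//.
  by move=> i; rewrite mem_enum => idf; split; [exact: p1|rewrite -dirsP].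
move=> B; rewrite -[RHS](p0 B); congr peval; apply/rowP => i; rewrite mxE mem_enum dirsP.
case: ltP => // fi; have /andP[h1 h2] := fx i.
rewrite mxE; case: ifP => _; apply/eqP; rewrite eq_le.
  by rewrite h2 (le_trans fi).
by rewrite h1 (le_trans h2).
Qed.

Lemma eq_box_int f p q : proper f -> (forall x, box_set f x -> peval p x = peval q x) ->
  box_int f (peval p) = box_int f (peval q).
Proof.
by move=> hf pq; apply/eqP; rewrite eq_le !le_box_int// => x /pq ->.
Qed.

(** Transversally to f, p and q need not be in Q_1. So p - q is replaced by the [v] in [Q1 (dirs f)]
    that agrees with it on f; [v] is an admissible test function, its square has zero integral, and
    [box_int_sq_ge] makes the vertex values vanish. *)
Lemma Q1_moments_eq f p q : proper f -> (forall i, i \in dirs f -> dle i 1 p /\ dle i 1 q) ->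
  (forall v, Q1 (dirs f) v -> box_int f (peval (p * v)) = box_int f (peval (q * v))) <->
  (forall B, peval p (vertex f B) = peval q (vertex f B)).
Proof.
move=> hf pq1; have d1 i : i \in dirs f -> dle i 1 (p - q).
  by move=> /pq1[? ?]; exact: dleB.
split=> [pq B|pq v _]; last first.
  apply: eq_box_int => // x fx; rewrite !pevalM; congr (_ * _); apply/eqP.
  rewrite -subr_eq0 -pevalB; apply/eqP; apply: deg1_box_eq0 fx => // B.
  by rewrite pevalB pq subrr.
have vE B' : vertex f (B' :&: dirs f)%SET = vertex f B'.
  apply/rowP => i; rewrite !mxE inE dirsP; case: (i \in B') => //=.
  by case: ltP => // h; apply/eqP; rewrite eq_le hf h.
have [v v1 vB] := Q1_interp (fun B => peval (p - q) (vertex f B)) (fintype.subxx (dirs f)).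
have vdle i : i \in dirs f -> dle i 1 v.
  by move=> idf; have /Q1P/(_ i) := v1; rewrite idf.
have pqv x : box_set f x -> peval (p - q) x = peval v x.
  move=> fx; apply/eqP; rewrite -subr_eq0 -pevalB; apply/eqP; apply: deg1_box_eq0 fx.
    by move=> i idf; apply: dleB; [exact: d1|exact: vdle].
  by move=> B'; rewrite pevalB vB vE subrr.
have v0 : box_int f (peval (v ^+ 2)) = 0.
  have <- : box_int f (peval (p * v - q * v)) = 0.
    by rewrite -scaleN1r box_intD box_intZ (pq v v1) mulN1r subrr.
  by apply: eq_box_int => // x fx; rewrite -mulrBl expr2 !pevalM pqv.
have := box_int_sq_ge B hf (fun i idf => @dleW _ _ i 1 2 _ isT (vdle i idf)).
rewrite v0 pmulr_rle0; last by rewrite divr_gt0 ?face_vol_gt0 ?exprn_gt0.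
rewrite le_eqVlt ltNge sqr_ge0 orbF sqrf_eq0 vB vE pevalB subr_eq0.
by move=> /eqP.
Qed.

Lemma is_face_dirs j T f : Defs.nondegenerate T -> is_face j T f -> #|dirs f| = j /\ proper f.
Proof.
move=> nT [s [A [sj ->]]]; split; last exact: proper_face.
by rewrite dirs_face.
Qed.

(** This form of the continuity condition, in which moments no longer occur, is the one used for the
    nodal basis. *)
Lemma S1p_meshP (Th : {fset box R n}) j (u : pform Th) :
  (forall T : Th, Defs.nondegenerate (val T)) ->
  S1p_mesh Th j u <-> (forall T : Th, S1p j (u T)) /\
    forall (T T' : Th) f, is_face j (val T) f -> is_face j (val T') f -> forall B,
      peval (u T (dirs f)) (vertex f B) = peval (u T' (dirs f)) (vertex f B).
Proof.
move=> nTh; split=> -[hu huf]; split=> // T T' f.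
  move=> Tf T'f; have [fj pf] := is_face_dirs (nTh T) Tf.
  apply/(Q1_moments_eq pf); first by move=> i idf; split; exact: S1p_dle1 (hu _) idf.
  by move=> v v1; rewrite -!face_int_wedge0; exact: huf.
move=> v Tf T'f v1; have [fj pf] := is_face_dirs (nTh T) Tf.
rewrite !face_int_wedge0; move: v v1; apply/(Q1_moments_eq pf).
  by move=> i idf; split; exact: S1p_dle1 (hu _) idf.
exact: huf.
Qed.

End Faces.

(** * The interpolant on one element *)

Section ElementInterpolant.
Context (R : realType) (n : nat).
Implicit Types (p q v : mpoly n R) (u w y z : Defs.form R n) (i l : 'I_n)
  (sigma tau A B C V s : {set 'I_n}) (x : 'rV[R]_n) (j : nat) (f T : box R n).

(** Mean over the vertices of the face with directions sigma through A; all subsets B are summed,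
    each vertex of the face being counted equally often. *)
Definition vavg T sigma u A : R :=
  2 ^- n * \sum_B peval (u sigma) (vertex T (glue sigma A B)).

Lemma vavgB T sigma u w A : vavg T sigma (u - w) A = vavg T sigma u A - vavg T sigma w A.
Proof.
rewrite /vavg -mulrBr -sumrB; congr (_ * _); apply: eq_bigr => B _.
by rewrite formBE pevalB.
Qed.

Lemma face_int_vavg T j sigma A u : Defs.nondegenerate T -> S1p j u ->
  face_int (face T sigma A) (tr (face T sigma A) u) =
  face_vol (face T sigma A) * vavg T sigma u A.
Proof.
move=> nT Su; rewrite face_int_tr dirs_face// box_int_deg1//; last first.
- by move=> i; rewrite dirs_face// => it; exact: S1p_dle1 Su it.
- exact: proper_face.
by congr (_ * (_ * _)); apply: eq_bigr => B _; rewrite vertex_face.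
Qed.

Lemma peval_deg0_eq sigma p x (x' : 'rV[R]_n) : (forall i, i \in sigma -> dle i 0 p) ->
  (forall i, i \notin sigma -> x 0 i = x' 0 i) -> peval p x = peval p x'.
Proof.
move=> p0 xx'; rewrite /peval !mevalE; apply: eq_big_seq => m mp.
congr (_ * _); apply: eq_bigr => i _.
have [is_|/xx' ->//] := boolP (i \in sigma).
by have := p0 i is_ m mp; rewrite leqn0 => /eqP ->; rewrite !expr0.
Qed.

Lemma Q1m_vavg T j sigma A w : Q1m j w -> vavg T sigma w A = peval (w sigma) (vertex T A).
Proof.
move=> /Q1mP[_ hw]; rewrite /vavg (eq_bigr (fun=> peval (w sigma) (vertex T A))).
  by rewrite sumr_set_const mulKf ?expf_neq0.
move=> B _; apply: (@peval_deg0_eq sigma) => i hi.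
  by have /Q1P/(_ i) := hw sigma; rewrite inE hi.
by rewrite [LHS]mxE [RHS]mxE in_glue (negbTE hi).
Qed.

Lemma element_interpolant T j u : Defs.nondegenerate T -> exists2 w, Q1m j w &
  forall sigma A, #|sigma| = j -> peval (w sigma) (vertex T A) = vavg T sigma u A.
Proof.
move=> nT.
have hp sigma : exists p, Q1 (~: sigma)%SET p /\
    forall A, peval p (vertex T A) = vavg T sigma u A.
  have [|p p1 pE] := @Q1_interp _ _ T (~: sigma)%SET (vavg T sigma u).
    by rewrite dirs_nondegenerate// finset.subsetT.
  exists p; split=> // A; rewrite pE /vavg; congr (_ * _); apply: eq_bigr => B _.
  congr (peval _ (vertex _ _)); apply/finset.setP => i; rewrite !in_glue.
  by case: ifPn => // is_; rewrite !inE is_ andbT.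
have [p pP] := choice hp.
exists [ffun sigma : {set 'I_n} => if #|sigma| == j then p sigma else 0].
  split=> sigma sj; rewrite ffunE; first by move/eqP/negbTE: sj => ->.
  by rewrite sj eqxx; case: (pP sigma).
by move=> sigma A sj; rewrite ffunE sj eqxx; case: (pP sigma) => _ ->.
Qed.

Lemma Q1_vertex_eq0 T p : Defs.nondegenerate T -> Q1 finset.setT p ->
  (forall V, peval p (vertex T V) = 0) -> p = 0.
Proof.
move=> nT p1 p0; have e0 i := edges_neq0 i nT.
have [e [_ pE]] := Q1_Ymon_expansion T.1 e0 p1.
rewrite pE big1// => A _; rewrite (moebius_eq0 (N := e)) ?scale0r// => V.
rewrite -[RHS](p0 V) pE peval_sum; apply: eq_bigr => B _; rewrite pevalZ peval_Ymon.
rewrite -(ypow_ind R) -(coords_vertex V nT); congr (_ * _).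
by apply: eq_bigr => i _; rewrite mxE.
Qed.

Lemma upd_vertex_snd T A i : upd (vertex T A) i (T.2 0 i) = vertex T (i |: A).
Proof. by apply/rowP => l; rewrite !mxE !inE; case: eqP => // ->. Qed.

Lemma upd_vertex_fst T A i : upd (vertex T A) i (T.1 0 i) = vertex T (A :\ i).
Proof. by apply/rowP => l; rewrite !mxE !inE; case: eqP => // ->. Qed.

Lemma glue_setU1 sigma A B i : i \notin sigma ->
  glue sigma (i |: A) B = (i |: glue sigma A B)%SET.
Proof.
move=> si; apply/finset.setP => l; rewrite in_glue !inE.
by case: (eqVneq l i) => [->|_] /=; rewrite ?(negbTE si)//; case: ifP => _; rewrite ?andbT ?andbF ?orbF.
Qed.

Lemma glue_setD1 sigma A B i : i \notin sigma ->
  glue sigma (A :\ i) B = (glue sigma A B :\ i)%SET.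
Proof.
move=> si; apply/finset.setP => l; rewrite in_glue !inE.
by case: (eqVneq l i) => [->|_] /=; rewrite ?(negbTE si)//; case: ifP => _; rewrite ?andbT ?andbF ?orbF.
Qed.

Lemma glue_setD1_setU1 tau A B i : i \in tau ->
  glue tau A (i |: B) = (i |: glue (tau :\ i) A B)%SET.
Proof.
move=> it; apply/finset.setP => l; rewrite in_glue !finset.in_setU1 in_glue finset.in_setD1.
by case: (eqVneq l i) => [->|_] /=; rewrite ?it.
Qed.

Lemma glue_setD1_setD1 tau A B i : i \in tau ->
  glue tau A (B :\ i) = (glue (tau :\ i) A B :\ i)%SET.
Proof.
move=> it; apply/finset.setP => l; rewrite in_glue !finset.in_setD1 in_glue finset.in_setD1.
by case: (eqVneq l i) => [->|_] /=; rewrite ?it.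
Qed.

(* Both sides are trapezoidal sums of d_i z over the edges in direction i, by
   exactness of the trapezoidal rule on d_i z, which has degree 1 in x_i. *)
Lemma vavg_mderiv T i tau A y z : Defs.nondegenerate T -> i \in tau ->
  dle i 1 (y (tau :\ i)%SET) -> dle i 2 (z (tau :\ i)%SET) ->
  (forall B, peval (y (tau :\ i)%SET) (vertex T B) = vavg T (tau :\ i)%SET z B) ->
  peval (mderiv i (y (tau :\ i)%SET)) (vertex T A) =
  2 ^- n * \sum_B peval (mderiv i (z (tau :\ i)%SET)) (vertex T (glue tau A B)).
Proof.
move=> nT it y1 z2 yz; set s := (tau :\ i)%SET.
have si : i \notin s by rewrite !inE eqxx.
have e0 : T.2 0 i - T.1 0 i != 0 by rewrite subr_eq0 gt_eqF.
apply: (mulfI e0).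
rewrite -(upd_id (vertex T A) i) (peval_deg1_mderiv _ _ _ _ y1) upd_vertex_fst upd_vertex_snd.
rewrite !yz /vavg -mulrBr -sumrB mulrCA; congr (_ * _).
pose G B := peval (mderiv i (z s)) (vertex T (glue tau A B)).
have -> : \sum_B peval (mderiv i (z s)) (vertex T (glue tau A B)) =
    \sum_B (G (i |: B)%SET + G (B :\ i)%SET) / 2.
  by rewrite -mulr_suml sum_setU1D1 -/(\sum_B G B); field.
rewrite mulr_sumr; apply: eq_bigr => B _.
rewrite /G glue_setU1// glue_setD1// glue_setD1_setU1// glue_setD1_setD1//.
have := peval_deg2_trapezoid (vertex T (glue s A B)) (T.1 0 i) (T.2 0 i) z2.
rewrite upd_vertex_fst upd_vertex_snd => <-.
by rewrite addrC; field.
Qed.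

(** The part q of u in Q_1^- is reproduced, so y = w - q interpolates the closed form z = d kappa b.
    By [vavg_mderiv], (dy)_tau at a vertex is the mean of (dz)_tau = 0 over the vertices of a face;
    being in Q_1, it vanishes. *)
Lemma dext_interpolant T j u w : Defs.nondegenerate T -> S1p j u -> Q1m j w ->
  (forall sigma A, #|sigma| = j -> peval (w sigma) (vertex T A) = vavg T sigma u A) ->
  dext w = dext u.
Proof.
move=> nT Su Qw wu; have := Su; move=> /(S1pP 0)[q [b [Qq hb uE]]].
pose z := dext (koszul_at 0 b).
have Sz : S1p j z.
  apply/(S1pP 0); exists 0, b; split=> //; last by rewrite add0r.
  by split=> s *; rewrite ffunE//; exact: Q1_0.
have Qy : Q1m j (w - q).
  by rewrite -scaleN1r; apply: Q1mD => //; exact: Q1mZ.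
suff dy : dext (w - q) = 0.
  rewrite uE dextD dext_dext addr0; apply/eqP; rewrite -subr_eq0 -dextB.
  exact/eqP.
have yz s B : #|s| = j -> peval ((w - q) s) (vertex T B) = vavg T s z B.
  move=> sj; have -> : z = u - q by rewrite uE addrC addKr.
  by rewrite formBE pevalB wu// vavgB (Q1m_vavg _ _ _ Qq).
have [jy hy] := (Q1mP _ _).1 Qy.
apply/ffunP => tau; rewrite [RHS]ffunE.
have [tj|tj] := eqVneq #|tau| j.+1; last first.
  by apply: (is_form_dext jy); exact/eqP.
have tDj i : i \in tau -> #|(tau :\ i)%SET| = j.
  by move=> it; have := cardsD1 i tau; rewrite it tj add1n => -[].
have y1 s i : dle i 1 ((w - q) s).
  by have /Q1P/(_ i) := hy s; apply: dleW; exact: leq_b1.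
apply: (Q1_vertex_eq0 nT).
  rewrite ffunE; apply: Q1_sum => i _; apply/Q1Z/Q1P => k.
  by apply: dle_mderiv; rewrite inE; exact: y1.
move=> A; rewrite ffunE peval_sum.
transitivity (2 ^- n * \sum_B peval (dext z tau) (vertex T (glue tau A B))).
  under [in RHS]eq_bigr do rewrite ffunE peval_sum.
  rewrite exchange_big mulr_sumr; apply: eq_bigr => i it /=.
  rewrite pevalZ (@vavg_mderiv T i tau A _ z nT it)//.
  - rewrite mulrCA; congr (_ * _); rewrite mulr_sumr; apply: eq_bigr => B _.
    by rewrite pevalZ.
  - exact: S1p_dle2 Sz.
  - by move=> B; apply: yz; exact: tDj.
by rewrite /z dext_dext big1 ?mulr0// => B _; rewrite ffunE peval0.
Qed.

(** Interchanging the parts of A and B inside sigma is an involution on pairs, after which F depends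
    on the first component only. *)
Lemma sum_glue sigma (F : {set 'I_n} -> R) :
  \sum_A \sum_B F (glue sigma A B) = 2 ^+ n * \sum_A F A.
Proof.
pose g (t : {set 'I_n} * {set 'I_n}) := (glue sigma t.1 t.2, glue sigma t.2 t.1).
have gK : involutive g.
  move=> [A B]; rewrite /g /=; congr (_, _); apply/finset.setP => i; rewrite !in_glue;
    by case: (i \in sigma).
rewrite pair_big /= (reindex_inj (inv_inj gK)) /=.
transitivity (\sum_(t : {set 'I_n} * {set 'I_n}) F t.1).
  apply: eq_bigr => -[A B] _; congr F; apply/finset.setP => i.
  by rewrite !in_glue; case: (i \in sigma).
rewrite -(pair_big xpredT xpredT (fun A _ => F A)) /= mulr_sumr.
by apply: eq_bigr => A _; rewrite sumr_set_const.
Qed.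

Lemma sum_vavg T sigma u :
  \sum_A vavg T sigma u A = \sum_A peval (u sigma) (vertex T A).
Proof.
by rewrite -mulr_sumr (sum_glue sigma (fun C => peval (u sigma) (vertex T C))) mulKf ?expf_neq0.
Qed.

Lemma mean_sqr_le (F : {set 'I_n} -> R) :
  (2 ^- n * \sum_B F B) ^+ 2 <= 2 ^- n * \sum_B F B ^+ 2.
Proof.
set m := 2 ^- n * _; have N0 : 0 < (2 : R) ^+ n by rewrite exprn_gt0.
have sF : \sum_B F B = 2 ^+ n * m by rewrite mulVKf// gt_eqF.
rewrite ler_pdivlMl// -subr_ge0.
have : 0 <= \sum_B (F B - m) ^+ 2 by apply: sumr_ge0 => B _; exact: sqr_ge0.
congr (0 <= _).
under eq_bigr do rewrite sqrrB.
rewrite big_split /= sumrB sumr_set_const.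
under [X in _ - X + _]eq_bigr do rewrite -mulr_natr -mulrA.
by rewrite -mulr_suml sF; ring.
Qed.

Lemma sum_vavg_sqr_le T sigma u :
  \sum_A vavg T sigma u A ^+ 2 <= \sum_A peval (u sigma) (vertex T A) ^+ 2.
Proof.
apply: (@le_trans _ _ (\sum_A 2 ^- n * \sum_B peval (u sigma) (vertex T (glue sigma A B)) ^+ 2)).
  by apply: ler_sum => A _; exact: mean_sqr_le.
rewrite -mulr_sumr (sum_glue sigma (fun C => peval (u sigma) (vertex T C) ^+ 2)).
by rewrite mulKf ?expf_neq0.
Qed.

End ElementInterpolant.

(** * Comparison of the two norms on one element *)

Section ElementNorms.
Context (R : realType) (n : nat).
Implicit Types (u v w : Defs.form R n) (sigma tau A B : {set 'I_n}) (x : 'rV[R]_n)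
  (j : nat) (T : box R n).

Definition inner_poly u v : mpoly n R := \sum_sigma u sigma * v sigma.

Lemma alt_innerE u v : alt_inner u v = peval (inner_poly u v).
Proof.
by apply/funext => x; rewrite peval_sum; apply: eq_bigr => s _; rewrite pevalM.
Qed.

Definition vertex_inner T u v : R := \sum_A alt_inner u v (vertex T A).

Lemma vertex_innerE T u v : vertex_inner T u v =
  \sum_sigma \sum_A peval (u sigma) (vertex T A) * peval (v sigma) (vertex T A).
Proof. by rewrite /vertex_inner /alt_inner exchange_big. Qed.

Lemma vertex_inner_ge0 T u : 0 <= vertex_inner T u u.
Proof.
by rewrite vertex_innerE; apply: sumr_ge0 => s _; apply: sumr_ge0 => A _; rewrite -expr2 sqr_ge0.
Qed.

Lemma volume_gt0 T : Defs.nondegenerate T -> 0 < volume T.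
Proof. by move=> nT; apply: prodr_gt0 => i _; rewrite subr_gt0. Qed.

Lemma face_vol_volume T : Defs.nondegenerate T -> face_vol T = volume T.
Proof. by move=> nT; rewrite /face_vol dirs_nondegenerate//; apply: eq_bigl => i; rewrite inE. Qed.

Lemma sqr_sum_le (J : finType) (F : J -> R) :
  (\sum_k F k) ^+ 2 <= #|J|%:R * \sum_k F k ^+ 2.
Proof.
have [J0|J0] := eqVneq #|J| 0%N.
  have F0 k : F k = 0 by have := fintype0 k J0.
  by rewrite (eq_bigr (fun=> 0)) ?big1_eq ?expr0n /= ?J0 ?mul0r// => k _; exact: F0.
have N0 : 0 < #|J|%:R :> R by rewrite ltr0n lt0n.
set S := \sum_k F k; rewrite -subr_ge0.
have : 0 <= #|J|%:R * \sum_k (F k - S / #|J|%:R) ^+ 2.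
  by apply: mulr_ge0 => //; apply: sumr_ge0 => k _; exact: sqr_ge0.
congr (0 <= _); under eq_bigr do rewrite sqrrB.
rewrite big_split /= sumrB sumr_const -[_ *+ #|_|]mulr_natl.
under [X in _ - X + _]eq_bigr do rewrite -mulr_natr -mulrA.
by rewrite -mulr_suml -/S; field; rewrite gt_eqF.
Qed.

Lemma box_int_vertex_inner T u v : Defs.nondegenerate T ->
  (forall i sigma, dle i 1 (u sigma * v sigma)) ->
  box_int T (alt_inner u v) = 2 ^- n * volume T * vertex_inner T u v.
Proof.
move=> nT uv1; rewrite alt_innerE box_int_deg1.
- by rewrite face_vol_volume// mulrCA mulrA /vertex_inner alt_innerE.
- exact: proper_nondegenerate.
- by move=> i _; apply: dle_sum => s _; exact: uv1.
Qed.

(** Each single vertex value satisfies volume T times u_s^2 <= 9^n times the integral of u_s^2;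
    averaging over the 2^n vertices costs no further factor. *)
Lemma vertex_inner_le T j u : Defs.nondegenerate T -> S1p j u ->
  2 ^- n * volume T * vertex_inner T u u <= 9 ^+ n * box_int T (alt_inner u u).
Proof.
move=> nT Su; rewrite alt_innerE box_int_sum vertex_innerE !mulr_sumr.
apply: ler_sum => s _; rewrite -mulrA ler_pdivrMl ?exprn_gt0// -sumr_set_const mulr_sumr.
apply: ler_sum => A _; rewrite -!expr2.
have := @box_int_sq_ge _ _ T (u s) A (proper_nondegenerate nT) (fun i _ => S1p_dle2 i Su).
rewrite face_vol_volume// dirs_nondegenerate// cardsT card_ord => h.
by rewrite -ler_pdivrMl ?exprn_gt0// mulrA [_^-1 * _]mulrC.
Qed.

Lemma box_int_le_vertex_inner j (gamma : R) : 0 <= gamma -> exists2 K : R, 0 <= K &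
  forall T (r : R), Defs.nondegenerate T -> 0 < r ->
    (forall i, r <= edges T 0 i <= gamma * r) ->
  forall u, S1p j u -> box_int T (alt_inner u u) <= K * (2 ^- n * volume T * vertex_inner T u u).
Proof.
move=> g0; have [K K0 hK] := @S1p_bound R n j gamma g0.
pose N : R := #|{set 'I_n}|%:R; pose M : R := #|{: {set 'I_n} * {set 'I_n}}|%:R.
(* The factor 2^n undoes the quadrature weight, [N] counts the components of the form, [K ^+ 2]
   comes from the pointwise bound and [M] from the Cauchy-Schwarz inequality over the pairs (sigma,
   A). *)
exists (2 ^+ n * (N * (K ^+ 2 * M))); first by rewrite !mulr_ge0 ?exprn_ge0.
move=> T r nT r0 Tr u Su.
have vE : \sum_(t : {set 'I_n} * {set 'I_n}) `|peval (u t.1) (vertex T t.2)| ^+ 2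
    = vertex_inner T u u.
  rewrite vertex_innerE pair_big /=; apply: eq_bigr => t _.
  by rewrite real_normK ?num_real// expr2.
have -> : 2 ^+ n * (N * (K ^+ 2 * M)) * (2 ^- n * volume T * vertex_inner T u u) =
    volume T * (N * (K ^+ 2 * (M * vertex_inner T u u))).
  by field; rewrite expf_neq0.
rewrite -(face_vol_volume nT) -(box_int_cst _ (proper_nondegenerate nT)) alt_innerE.
apply: le_box_int => [|x Tx]; first exact: proper_nondegenerate.
rewrite pevalC peval_sum; apply: (@le_trans _ _ (\sum_(s : {set 'I_n})
  K ^+ 2 * (M * vertex_inner T u u))); last first.
  by rewrite sumr_const -[_ *+ _]mulr_natl.
apply: ler_sum => s _; rewrite pevalM -expr2 -real_normK ?num_real//.
apply: (@le_trans _ _ ((K * \sum_(t : {set 'I_n} * {set 'I_n}) `|peval (u t.1) (vertex T t.2)|) ^+ 2)).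
  by rewrite ler_sqr ?nnegrE ?mulr_ge0 ?sumr_ge0//; exact: (hK T r nT r0 Tr u Su).
rewrite exprMn; apply: ler_wpM2l; first exact: sqr_ge0.
by rewrite -vE; exact: sqr_sum_le.
Qed.

End ElementNorms.

(** * Inner products and interpolation on the mesh *)

Section MeshNorms.
Context (R : realType) (n : nat) (Th : {fset box R n}).
Hypothesis nTh : forall T : Th, Defs.nondegenerate (val T).
Implicit Types (u v w : pform Th) (T : Th) (j : nat) (sigma A : {set 'I_n}).

Lemma h_innerE u v : h_inner u v =
  \sum_T 2 ^- n * volume (val T) * vertex_inner (val T) (u T) (v T).
Proof. by []. Qed.

Lemma pformDE u v T : (u + v) T = u T + v T.
Proof. by rewrite ffunE. Qed.
Lemma pformZE (a : R) u T : (a *: u) T = a *: u T.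
Proof. by rewrite ffunE. Qed.

Lemma h_innerC u v : h_inner u v = h_inner v u.
Proof.
rewrite !h_innerE; apply: eq_bigr => T _; congr (_ * _); rewrite !vertex_innerE.
by apply: eq_bigr => s _; apply: eq_bigr => A _; rewrite mulrC.
Qed.

Lemma h_inner_linear (a : R) u v w : h_inner (a *: u + v) w = a * h_inner u w + h_inner v w.
Proof.
rewrite !h_innerE mulr_sumr -big_split; apply: eq_bigr => T _ /=.
rewrite mulrCA -mulrDr; congr (_ * _); rewrite !vertex_innerE mulr_sumr -big_split.
apply: eq_bigr => s _ /=; rewrite mulr_sumr -big_split; apply: eq_bigr => A _ /=.
by rewrite pformDE pformZE formDE formZE pevalD pevalZ; ring.
Qed.

Lemma h_innerB u v w : h_inner (u - v) w = h_inner u w - h_inner v w.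
Proof. by rewrite addrC -scaleN1r h_inner_linear mulN1r addrC. Qed.

Lemma weight_gt0 T : 0 < 2 ^- n * volume (val T).
Proof. by rewrite mulr_gt0 ?invr_gt0 ?exprn_gt0// volume_gt0. Qed.

Lemma h_inner_ge0 u : 0 <= h_inner u u.
Proof.
rewrite h_innerE; apply: sumr_ge0 => T _.
by rewrite mulr_ge0 ?vertex_inner_ge0 ?ltW// weight_gt0.
Qed.

Lemma mesh_vertex_inj j u : (forall T, S1p j (u T)) ->
  (forall T sigma A, peval (u T sigma) (vertex (val T) A) = 0) -> u = 0.
Proof.
move=> Su u0; apply/ffunP => T; rewrite [RHS]ffunE.
by apply: (S1p_vertex_inj (nTh T) (Su T)) => s A; exact: u0.
Qed.

Lemma h_inner_eq0 j u : (forall T, S1p j (u T)) -> h_inner u u = 0 -> u = 0.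
Proof.
move=> Su uu; apply: (mesh_vertex_inj Su) => T s A.
have T0 : 2 ^- n * volume (val T) * vertex_inner (val T) (u T) (u T) = 0.
  apply: (psumr_eq0P _ uu) => // T' _.
  by rewrite mulr_ge0 ?vertex_inner_ge0 ?ltW// weight_gt0.
have sq0 t B : 0 <= peval (u T t) (vertex (val T) B) * peval (u T t) (vertex (val T) B).
  by rewrite -expr2 sqr_ge0.
move/eqP: T0; rewrite mulf_eq0 gt_eqF ?weight_gt0//= vertex_innerE => /eqP T0.
have s0 := psumr_eq0P (fun t _ => sumr_ge0 _ (fun B _ => sq0 t B)) T0 (i := s) isT.
have := psumr_eq0P (fun B _ => sq0 s B) s0 (i := A) isT.
by move=> /eqP; rewrite -expr2 sqrf_eq0 => /eqP.
Qed.

Lemma l2_inner_ge0 j u : (forall T, S1p j (u T)) -> 0 <= l2_inner u u.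
Proof.
move=> Su; apply: sumr_ge0 => T _; rewrite -(pmulr_rge0 _ (exprn_gt0 n (ltr0n _ 9))).
apply: le_trans (vertex_inner_le (nTh T) (Su T)).
by rewrite mulr_ge0 ?vertex_inner_ge0 ?ltW// weight_gt0.
Qed.

Lemma h_norm_le j u : (forall T, S1p j (u T)) ->
  h_norm u <= Num.sqrt (9 ^+ n) * l2_norm u.
Proof.
move=> Su; rewrite /h_norm /l2_norm -sqrtrM ?exprn_ge0// ler_sqrt; last first.
  by rewrite mulr_ge0 ?exprn_ge0// (l2_inner_ge0 Su).
rewrite h_innerE mulr_sumr; apply: ler_sum => T _.
exact: vertex_inner_le (nTh T) (Su T).
Qed.

Lemma l2_norm_le j (K : R) u : 0 <= K -> (forall T, S1p j (u T)) ->
  (forall T (v : Defs.form R n), S1p j v -> box_int (val T) (alt_inner v v) <=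
     K * (2 ^- n * volume (val T) * vertex_inner (val T) v v)) ->
  l2_norm u <= Num.sqrt K * h_norm u.
Proof.
move=> K0 Su hK; rewrite /h_norm /l2_norm -sqrtrM// ler_sqrt; last first.
  by rewrite mulr_ge0// h_inner_ge0.
by rewrite h_innerE mulr_sumr; apply: ler_sum => T _; exact: hK.
Qed.

(** The elementwise interpolants fit together: their face integrals are those of u, and these are
    single-valued because v = 1 is among the test functions in [S1p_mesh]. *)
Lemma is_interpolantP j u w : S1p_mesh Th j u ->
  is_interpolant j u w <-> (forall T, Q1m j (w T)) /\
    forall T sigma A, #|sigma| = j ->
      peval (w T sigma) (vertex (val T) A) = vavg (val T) sigma (u T) A.
Proof.
move=> [Su hu]; split.
  move=> [[Qw _] wu]; split=> // T s A sj.
  have Tf : is_face j (val T) (face (val T) s A) by exists s, A.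
  have := wu T _ Tf; rewrite (face_int_vavg _ _ (nTh T) (Su T)).
  rewrite (face_int_vavg _ _ (nTh T) (Q1m_S1p (Qw T))) (Q1m_vavg _ _ _ (Qw T)).
  by apply: mulfI; rewrite gt_eqF// face_vol_gt0.
move=> [Qw wu]; have wf T f : is_face j (val T) f ->
    face_int f (tr f (w T)) = face_int f (tr f (u T)).
  move=> [s [A [sj ->]]]; rewrite (face_int_vavg _ _ (nTh T) (Su T)).
  by rewrite (face_int_vavg _ _ (nTh T) (Q1m_S1p (Qw T))) (Q1m_vavg _ _ _ (Qw T)) wu.
split=> //; split=> // T T' f Tf T'f; rewrite !wf//.
have Q11 : Q1 (dirs f) (1 : mpoly n R).
  by apply/Q1P => i; apply: (@dleW _ _ _ 0) => //; rewrite -mpolyC1; exact: dleC.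
have w1 (v : Defs.form R n) : wedge0 v 1 = v by apply/ffunP => s; rewrite ffunE mulr1.
by have := hu T T' f 1 Tf T'f Q11; rewrite !w1.
Qed.

Lemma interpolant_unique j u : S1p_mesh Th j u -> exists! w, is_interpolant j u w.
Proof.
move=> hu; have [Su _] := hu.
have hw T : exists w : Defs.form R n, Q1m j w /\ forall sigma A, #|sigma| = j ->
    peval (w sigma) (vertex (val T) A) = vavg (val T) sigma (u T) A.
  by have [w w1 w2] := element_interpolant j (u T) (nTh T); exists w.
have [w wP] := choice hw.
exists [ffun T => w T]; split.
  apply/(is_interpolantP _ hu); split=> [T|T s A sj]; rewrite ffunE; first by case: (wP T).
  by case: (wP T) => _; exact.
move=> w' /(is_interpolantP _ hu)[Qw' w'u]; apply/ffunP => T; rewrite ffunE.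
have [Qw wu] := wP T; apply/eqP; rewrite -subr_eq0; apply/eqP.
apply: (@S1p_vertex_inj _ _ j _ _ (nTh T)).
  by apply: S1pD; [exact: Q1m_S1p|rewrite -scaleN1r; apply: S1pZ; exact: Q1m_S1p].
move=> s A; rewrite formBE pevalB; have [sj|/eqP sj] := eqVneq #|s| j.
  by rewrite wu// w'u// subrr.
by rewrite (Qw.1 _ sj) ((Qw' T).1 _ sj) subrr.
Qed.

Lemma interpolant_dmesh j u w : S1p_mesh Th j u -> is_interpolant j u w ->
  dmesh w = dmesh u.
Proof.
move=> hu /(is_interpolantP _ hu)[Qw wu]; apply/ffunP => T; rewrite !ffunE.
by apply: (dext_interpolant (nTh T) (hu.1 T) (Qw T)) => s A; exact: wu.
Qed.

Lemma interpolant_h_inner j u w t0 : S1p_mesh Th j u -> is_interpolant j u w ->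
  const_mesh Th j t0 -> h_inner w t0 = h_inner u t0.
Proof.
move=> hu /(is_interpolantP _ hu)[Qw wu] ht0; rewrite !h_innerE.
apply: eq_bigr => T _; congr (_ * _); rewrite !vertex_innerE; apply: eq_bigr => s _.
have [jt0 /(_ s)[c cE]] := ht0 T; rewrite cE.
under eq_bigr do rewrite pevalC; under [RHS]eq_bigr do rewrite pevalC.
rewrite -!mulr_suml; congr (_ * _); have [sj|/eqP sj] := eqVneq #|s| j.
  by under eq_bigr do rewrite wu//; exact: sum_vavg.
by rewrite ((Qw T).1 _ sj) (S1p_is_form (hu.1 T) sj).
Qed.

(** Vertex values of w are face means of those of u, so Jensen's inequality on each face gives
    constant 1. *)
Lemma interpolant_h_norm j u w : S1p_mesh Th j u -> is_interpolant j u w ->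
  h_norm w <= h_norm u.
Proof.
move=> hu /(is_interpolantP _ hu)[Qw wu]; rewrite ler_sqrt ?h_inner_ge0// !h_innerE.
apply: ler_sum => T _; apply: ler_wpM2l; first exact/ltW/weight_gt0.
rewrite !vertex_innerE; apply: ler_sum => s _.
have [sj|/eqP sj] := eqVneq #|s| j.
  under eq_bigr do rewrite wu// -expr2; under [leRHS]eq_bigr do rewrite -expr2.
  exact: sum_vavg_sqr_le.
by rewrite ((Qw T).1 _ sj) (S1p_is_form (hu.1 T) sj).
Qed.

Lemma l2_h_inner_const j u t0 : Q1m_mesh Th j u -> const_mesh Th j t0 ->
  l2_inner u t0 = h_inner u t0.
Proof.
move=> [Qu _] ht0; rewrite h_innerE; apply: eq_bigr => T _.
apply: box_int_vertex_inner => // i s; have [_ /(_ s)[c ->]] := ht0 T.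
rewrite mulrC mul_mpolyC; apply: dleZ.
by have [_ /(_ s)/Q1P/(_ i)] := (Q1mP _ _).1 (Qu T); apply: dleW; exact: leq_b1.
Qed.

End MeshNorms.

(** * Nodal basis, existence and locality of the coderivative *)

Section Coderivative.
Context (R : realType) (n : nat) (Th : {fset box R n}) (j : nat).
Hypothesis nTh : forall T : Th, Defs.nondegenerate (val T).
Implicit Types (u v w tau : pform Th) (T : Th) (sigma A B : {set 'I_n}).
Local Notation I := (Th * {set 'I_n} * {set 'I_n})%type.
Implicit Types (t k m : I).

Definition vval u t : R := peval (u t.1.1 t.1.2) (vertex (val t.1.1) t.2).

(* Two entries of the table of vertex values carry the same degree of freedom
   when they have the same key: a face and a vertex of it. *)
Definition key t : box R n * 'rV[R]_n :=
  (face (val t.1.1) t.1.2 t.2, vertex (val t.1.1) t.2).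

Lemma key_dirs t : dirs (key t).1 = t.1.2.
Proof. by rewrite dirs_face. Qed.

Lemma key_sigma t k : key t = key k -> t.1.2 = k.1.2.
Proof. by move=> tk; rewrite -(key_dirs t) tk key_dirs. Qed.

Lemma glue_id sigma A : glue sigma A A = A.
Proof. by apply/finset.setP => i; rewrite in_glue if_same. Qed.

Lemma face_glue (T : box R n) sigma A B : face T sigma (glue sigma A B) = face T sigma A.
Proof.
by congr pair; apply/rowP => i; rewrite !mxE in_glue; case: (i \in sigma).
Qed.

Lemma vval_form0 u t : S1p j (u t.1.1) -> #|t.1.2| <> j -> vval u t = 0.
Proof. by move=> Su tj; rewrite /vval (S1p_is_form Su tj) peval0. Qed.

Lemma vval_key u t k : S1p_mesh Th j u -> key t = key k -> vval u t = vval u k.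
Proof.
move=> /(S1p_meshP _ _ nTh)[Su hu] tk; have tks := key_sigma tk.
have [tj|/eqP tj] := eqVneq #|t.1.2| j; last first.
  by rewrite !vval_form0// -tks.
have ft : is_face j (val t.1.1) (key t).1 by exists t.1.2, t.2.
have fk : is_face j (val k.1.1) (key t).1 by rewrite tk; exists k.1.2, k.2; split=> //; rewrite -tks.
have := hu _ _ _ ft fk t.2; rewrite key_dirs vertex_face glue_id. rewrite -/(vval u t) => ->.
by have /= -> := congr1 snd tk; rewrite tks.
Qed.

(** Entries that the continuity condition compares have equal keys, so elementwise interpolation of
    a table compatible with [key] is conforming. In particular a member of the space may be cut off
    at a single vertex. *)
Lemma mesh_interp (v : I -> R) : (forall t, #|t.1.2| <> j -> v t = 0) ->
  (forall t k, key t = key k -> v t = v k) ->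
  exists2 u, S1p_mesh Th j u & forall t, vval u t = v t.
Proof.
move=> vj vk.
have hu T : exists u : Defs.form R n, S1p j u /\
    forall sigma A, peval (u sigma) (vertex (val T) A) = v (T, sigma, A).
  have [|u u1 u2] := @S1p_interp _ _ j (val T) (fun s A => v (T, s, A)) (nTh T); last by exists u.
  by move=> s A sj; exact: vj.
have [u uP] := choice hu.
have uv t : vval [ffun T => u T] t = v t.
  by case: t => [[T s] A]; rewrite /vval ffunE /=; case: (uP T) => _ ->.
exists [ffun T => u T] => //; apply/(S1p_meshP _ _ nTh); split=> [T|T T' f].
  by rewrite ffunE; case: (uP T).
move=> [s [A [sj fE]]] [s' [A' [sj' fE']]] B.
have fs : dirs f = s by rewrite fE dirs_face.
have fs' : dirs f = s' by rewrite fE' dirs_face.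
have v1 : vertex f B = vertex (val T) (glue s A B) by rewrite fE vertex_face.
have v2 : vertex f B = vertex (val T') (glue s A' B) by rewrite fE' -fs' fs vertex_face.
have uE K r C : peval (u K r) (vertex (val K) C) = v (K, r, C) by case: (uP K).
rewrite !ffunE {1}v1 v2 fs !uE; apply: vk.
by rewrite /key /= !face_glue -v1 -v2 -fE fE' -fs' fs.
Qed.

Lemma S1p_meshD (a : R) u v : S1p_mesh Th j u -> S1p_mesh Th j v ->
  S1p_mesh Th j (a *: u + v).
Proof.
move=> /(S1p_meshP _ _ nTh)[Su hu] /(S1p_meshP _ _ nTh)[Sv hv].
apply/(S1p_meshP _ _ nTh); split=> [T|T T' f Tf T'f B].
  by rewrite pformDE pformZE; apply: S1pD => //; exact: S1pZ.
rewrite !pformDE !pformZE !formDE !formZE !pevalD !pevalZ.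
by rewrite (hu _ _ _ Tf T'f) (hv _ _ _ Tf T'f).
Qed.

Lemma S1p_mesh0 : S1p_mesh Th j 0.
Proof.
apply/(S1p_meshP _ _ nTh); split=> [T|T T' f _ _ B]; first by rewrite ffunE; exact: S1p_0.
by rewrite !ffunE !peval0.
Qed.

Lemma vval_linear (a : R) u v t : vval (a *: u + v) t = a * vval u t + vval v t.
Proof. by rewrite /vval pformDE pformZE formDE formZE pevalD pevalZ. Qed.

Lemma vval_inj u v : S1p_mesh Th j u -> S1p_mesh Th j v ->
  (forall t, vval u t = vval v t) -> u = v.
Proof.
move=> hu hv uv; apply/eqP; rewrite -subr_eq0 addrC -scaleN1r; apply/eqP.
have [Sw _] := S1p_meshD (-1) hv hu.
apply: (mesh_vertex_inj nTh Sw) => T s A.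
have := vval_linear (-1) v u (T, s, A); rewrite /vval /= => ->.
by have := uv (T, s, A); rewrite /vval /= => ->; rewrite mulN1r addNr.
Qed.

Definition weight t : R := 2 ^- n * volume (val t.1.1).

Lemma h_inner_vval u v : h_inner u v = \sum_t weight t * (vval u t * vval v t).
Proof.
rewrite h_innerE -(pair_big xpredT xpredT (fun (p : Th * {set 'I_n}) A =>
  weight (p, A) * (vval u (p, A) * vval v (p, A)))) /=.
rewrite -(pair_big xpredT xpredT (fun T sigma =>
  \sum_A weight (T, sigma, A) * (vval u (T, sigma, A) * vval v (T, sigma, A)))) /=.
apply: eq_bigr => T _; rewrite vertex_innerE mulr_sumr; apply: eq_bigr => s _.
by rewrite mulr_sumr.
Qed.

Lemma dmeshE u T : dmesh u T = dext (u T).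
Proof. by rewrite ffunE. Qed.

Lemma l2_dmesh_linear u (a : R) v w :
  l2_inner u (dmesh (a *: v + w)) = a * l2_inner u (dmesh v) + l2_inner u (dmesh w).
Proof.
rewrite /l2_inner mulr_sumr -big_split; apply: eq_bigr => T _ /=.
rewrite !alt_innerE -box_intZ -box_intD; congr (box_int _ (peval _)).
rewrite /inner_poly scaler_sumr -big_split; apply: eq_bigr => s _ /=.
by rewrite !dmeshE pformDE pformZE dextD dextZ formDE formZE mulrDr scalerAr.
Qed.

Lemma l2_dmesh0 u : l2_inner u (dmesh 0) = 0.
Proof.
have := l2_dmesh_linear u 1 0 0; rewrite scaler0 addr0 mul1r => h; lra.
Qed.

Lemma l2_dmesh_sum u (a : I -> R) (E : I -> pform Th) (r : seq I) :
  l2_inner u (dmesh (\sum_(k <- r) a k *: E k)) = \sum_(k <- r) a k * l2_inner u (dmesh (E k)).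
Proof.
elim: r => [|k r IH]; first by rewrite !big_nil l2_dmesh0.
by rewrite !big_cons l2_dmesh_linear IH.
Qed.

Lemma vval_sum (a : I -> R) (E : I -> pform Th) (r : seq I) t :
  vval (\sum_(k <- r) a k *: E k) t = \sum_(k <- r) a k * vval (E k) t.
Proof.
elim: r => [|k r IH]; first by rewrite !big_nil /vval !ffunE peval0.
by rewrite !big_cons vval_linear IH.
Qed.

Lemma S1p_mesh_sum (a : I -> R) (E : I -> pform Th) (r : seq I) :
  (forall k, S1p_mesh Th j (E k)) -> S1p_mesh Th j (\sum_(k <- r) a k *: E k).
Proof.
move=> hE; elim: r => [|k r IH]; first by rewrite big_nil; exact: S1p_mesh0.
by rewrite big_cons; exact: S1p_meshD.
Qed.

(* The nodal basis E_k is orthogonal for the quadrature inner product, so the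
   nodal values of the coderivative are quotients. *)
Lemma coderivative_exists u : exists w, is_coderivative j u w.
Proof.
have hE k : exists E : pform Th, S1p_mesh Th j E /\
    forall t, vval E t = ((key t == key k) && (#|t.1.2| == j))%:R.
  have [|t t' tt'|E E1 E2] := @mesh_interp (fun t => ((key t == key k) && (#|t.1.2| == j))%:R).
  - by move=> t /eqP/negbTE ->; rewrite andbF.
  - by rewrite tt' (key_sigma tt').
  - by exists E.
have [E EP] := choice hE.
(* For an entry of degree j this is [h_inner (E k) (E k)]. *)
pose cw k := \sum_(t | key t == key k) weight t.
have cw0 k : 0 < cw k.
  rewrite /cw (bigD1 k)//= ltr_pwDl//; first exact: weight_gt0.
  by apply: sumr_ge0 => t _; exact/ltW/weight_gt0.
pose val_ k := if #|k.1.2| == j then l2_inner u (dmesh (E k)) / cw k else 0.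
have [||w hw wv] := @mesh_interp val_.
- by move=> t /eqP/negbTE tj; rewrite /val_ tj.
- move=> t k tk; rewrite /val_ (key_sigma tk) /cw tk; case: ifP => // _.
  congr (l2_inner _ (dmesh _) / _); apply: vval_inj; [by case: (EP t)|by case: (EP k)|].
  by move=> m; case: (EP t) => _ ->; case: (EP k) => _ ->; rewrite tk.
exists w; split=> // tau htau; have [Stau _] := htau.
(* The family [E] is indexed by table entries, so equal keys repeat the same basis form. The shares
   [weight k / cw k] add up to 1 over a key class, so each degree of freedom is counted once. *)
pose a k := weight k * vval tau k / cw k.
have tauE : tau = \sum_k a k *: E k.
  apply: vval_inj => //; first by apply: S1p_mesh_sum => k; case: (EP k).
  move=> t; rewrite vval_sum.
  have [tj|/eqP tj] := eqVneq #|t.1.2| j; last first.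
    rewrite vval_form0// big1// => k _; case: (EP k) => _ ->.
    by move/eqP/negbTE: tj => ->; rewrite andbF mulr0.
  rewrite (bigID (fun k => key k == key t)) /= [X in _ + X]big1 ?addr0; last first.
    by move=> k /negbTE kt; case: (EP k) => _ ->; rewrite eq_sym kt mulr0.
  rewrite (eq_bigr (fun k => weight k * (vval tau t / cw t))).
    by rewrite -mulr_suml -/(cw t) mulrCA divff ?mulr1// gt_eqF.
  move=> k /eqP kt; case: (EP k) => _ ->; rewrite kt eqxx tj eqxx mulr1 /a.
  by rewrite (vval_key htau kt) /cw kt mulrA.
rewrite h_inner_vval {2}tauE l2_dmesh_sum; apply: eq_bigr => k _; rewrite wv /val_ /a.
case: ifP => [_|/eqP kj]; first by ring.
by rewrite vval_form0//; ring.
Qed.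

Lemma S1p_meshB u v : S1p_mesh Th j u -> S1p_mesh Th j v -> S1p_mesh Th j (u - v).
Proof. by move=> hu hv; rewrite addrC -scaleN1r; exact: S1p_meshD. Qed.

Lemma coderivative_unique u : exists! w, is_coderivative j u w.
Proof.
have [w [hw wE]] := coderivative_exists u; exists w; split=> // w' [hw' w'E].
have hww' := S1p_meshB hw hw'.
apply/eqP; rewrite -subr_eq0; apply/eqP; apply: (h_inner_eq0 nTh hww'.1).
by rewrite h_innerB wE// w'E// subrr.
Qed.

(* Test with the part of w - w' supported at the vertex x. *)
Lemma coderivative_local u u' w w' (x : 'rV[R]_n) :
  is_coderivative j u w -> is_coderivative j u' w' ->
  (forall T, is_vertex (val T) x -> u T = u' T) ->
  forall T sigma, is_vertex (val T) x -> peval (w T sigma) x = peval (w' T sigma) x.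
Proof.
move=> [hw wE] [hw' w'E] uu' T s [A xE].
have hz := S1p_meshB hw hw'; set z := w - w' in hz.
(* The key records the vertex, hence the cut-off respects keys. *)
have [||tau htau tauE] := @mesh_interp (fun t => ((key t).2 == x)%:R * vval z t).
- by move=> t tj; rewrite vval_form0 ?mulr0//; exact: hz.1.
- by move=> t k tk; rewrite tk (vval_key hz tk).
have l2E : l2_inner u (dmesh tau) = l2_inner u' (dmesh tau).
  apply: eq_bigr => K _; have [Kx|Kx] := pselect (is_vertex (val K) x).
    by rewrite uu'.
  (* On an element without the vertex x all vertex values of tau are zero, so tau vanishes there by
     unisolvence, and with it d tau. *)
  suff -> : dmesh tau K = 0.
    by rewrite !alt_innerE /inner_poly !big1// => r _; rewrite ffunE mulr0.
  rewrite dmeshE (_ : tau K = 0) ?dext0//.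
  apply: (S1p_vertex_inj (nTh K) (htau.1 K)) => r B.
  have := tauE (K, r, B); rewrite /vval /= => ->.
  by case: eqP => [Bx|]; [case: Kx; exists B|rewrite mul0r].
have : h_inner z tau = 0 by rewrite h_innerB wE// w'E// l2E subrr.
have sqE t : weight t * (vval z t * vval tau t) = weight t * (((key t).2 == x)%:R * vval z t ^+ 2).
  by rewrite tauE; ring.
rewrite h_inner_vval; under eq_bigr do rewrite sqE.
have w0 t : 0 < weight t := weight_gt0 nTh t.1.1.
move=> sum0; have term0 := psumr_eq0P _ sum0 (i := (T, s, A)) isT.
have /eqP : weight (T, s, A) * (((key (T, s, A)).2 == x)%:R * vval z (T, s, A) ^+ 2) = 0.
  by apply: term0 => t _; apply: mulr_ge0; [exact: ltW|rewrite mulr_ge0 ?sqr_ge0].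
rewrite mulf_eq0 gt_eqF//= xE eqxx mul1r sqrf_eq0.
have -> : z = -1 *: w' + w by rewrite scaleN1r addrC.
by rewrite vval_linear mulN1r addrC subr_eq0 => /eqP.
Qed.

End Coderivative.

(** * Edge lengths of shape-regular elements *)

Section ShapeRegular.
Context (R : realType) (n : nat).

Lemma enorm_scale_delta (a : R) (i : 'I_n) : enorm (a *: delta_mx 0 i) = `|a|.
Proof.
rewrite /enorm (bigD1 i)//= big1 => [|l li]; rewrite !mxE ?eqxx.
  by rewrite addr0 mulr1 sqrtr_sqr.
by rewrite (negbTE li) mulr0 expr0n.
Qed.

(** Moving from the centre of the inscribed ball by r along an axis stays in T, so every edge is at
    least r; an edge joins two points of T, so the diameter bounds it above. The absolute value of
    gamma is taken since a family without elements does not force gamma >= 0. *)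
Lemma shape_regular_edges (H : Type) (Th : H -> {fset box R n}) :
  (forall h (T : Th h), Defs.nondegenerate (val T)) -> shape_regular Th ->
  exists2 gamma : R, 0 <= gamma & forall h (T : Th h), exists2 r : R, 0 < r &
    forall i, r <= edges (val T) 0 i <= gamma * r.
Proof.
move=> nT [gamma hg]; exists `|gamma| => // h T; have [c [r [r0 hball hdiam]]] := hg h T.
exists r => // i; set K := val T in hball hdiam *.
have cK : box_set K c.
  by apply: hball; rewrite subrr -(scale0r (delta_mx 0 i)) enorm_scale_delta normr0 ltW.
apply/andP; split.
  have /(_ i) : box_set K (c + r *: delta_mx 0 i).
    by apply: hball; rewrite addrC addKr enorm_scale_delta gtr0_norm.
  rewrite !mxE !eqxx mulr1 => /andP[_ h2]; have /andP[h1 _] := cK i.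
  by move: h1 h2; lra.
have vK A : box_set K (vertex K A).
  by move=> l; rewrite mxE; case: ifP => _; rewrite lexx ?andbT ltW// nT.
have := hdiam _ _ (vK [set i]%SET) (vK finset.set0).
have -> : vertex K [set i]%SET - vertex K finset.set0 = edges K 0 i *: delta_mx 0 i.
  apply/rowP => l; rewrite !mxE !inE eqxx /=.
  by case: (eqVneq l i) => [->|_]; rewrite ?mulr1 ?mulr0 ?subrr.
rewrite enorm_scale_delta gtr0_norm ?edges_gt0//; last exact: nT.
by move=> /le_trans; apply; apply: ler_wpM2r; [exact: ltW|exact: ler_norm].
Qed.

End ShapeRegular.

(** * Assembly of the constants and of the three assertions *)

Theorem mainTheorem4 (R : realType) (n k : nat) (hk : (1 <= k <= n)%N)
  (Omega : set 'rV[R]_n) (hOmega : bounded_domain Omega)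
  (H : Type) (Th : H -> {fset box R n})
  (hTh : forall h, cubical_mesh Omega (Th h)) (hreg : shape_regular Th) :
  (* (A) *)
  (exists c C : R, [/\ 0 < c, 0 < C & forall h,
     inner_product_on (S1p_mesh (Th h) k.-1) h_inner /\
     forall v, S1p_mesh (Th h) k.-1 v ->
       c * l2_norm v <= h_norm v <= C * l2_norm v]) /\
  (* (B) *)
  (exists C : R, forall h,
     [/\ forall tau tau0, Q1m_mesh (Th h) k.-1 tau ->
           const_mesh (Th h) k.-1 tau0 ->
           l2_inner tau tau0 = h_inner tau tau0,
         forall tau, S1p_mesh (Th h) k.-1 tau ->
           exists! w, is_interpolant k.-1 tau w
       & forall tau w, S1p_mesh (Th h) k.-1 tau ->
           is_interpolant k.-1 tau w ->
           [/\ dmesh w = dmesh tau,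
               l2_norm w <= C * l2_norm tau
             & forall tau0, const_mesh (Th h) k.-1 tau0 ->
                 h_inner w tau0 = h_inner tau tau0]]) /\
  (* (Locality) *)
  (forall h,
     (forall u, Q1m_mesh (Th h) k u ->
        exists! w, is_coderivative k.-1 u w) /\
     forall u u' w w', Q1m_mesh (Th h) k u -> Q1m_mesh (Th h) k u' ->
       is_coderivative k.-1 u w -> is_coderivative k.-1 u' w' ->
       forall x : 'rV[R]_n,
         (forall T : Th h, is_vertex (val T) x -> u T = u' T) ->
         forall (T : Th h) (sigma : {set 'I_n}), is_vertex (val T) x ->
           peval (w T sigma) x = peval (w' T sigma) x).
Proof.
have nT h (T : Th h) : Defs.nondegenerate (val T) by case: (hTh h).
have [gamma g0 hgamma] := shape_regular_edges nT hreg.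
set j := k.-1.
have [K K0 hK] := @box_int_le_vertex_inner R n j gamma g0.
(* [K] may be 0; K + 1 has a positive square root, whose inverse is the lower constant in (A). *)
have hKT h (T : Th h) v : S1p j v -> box_int (val T) (alt_inner v v) <=
    (K + 1) * (2 ^- n * volume (val T) * vertex_inner (val T) v v).
  move=> Sv; have [r r0 hr] := hgamma h T; apply: (le_trans (hK _ _ (nT h T) r0 hr _ Sv)).
  apply: ler_wpM2r; last by rewrite lerDl.
  by rewrite mulr_ge0 ?vertex_inner_ge0// ltW// weight_gt0.
have K1 : 0 < Num.sqrt (K + 1) by rewrite sqrtr_gt0 ltr_wpDl.
have l2h h (u : pform (Th h)) : (forall T, S1p j (u T)) ->
    l2_norm u <= Num.sqrt (K + 1) * h_norm u.
  by move=> Su; apply: (l2_norm_le (nT h) _ Su) => [|T v]; [rewrite addr_ge0|exact: hKT].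
split; [|split].
- exists (Num.sqrt (K + 1))^-1, (Num.sqrt (9 ^+ n)); split.
  + by rewrite invr_gt0.
  + by rewrite sqrtr_gt0 exprn_gt0.
  move=> h; split; last first.
    by move=> v [Sv _]; rewrite ler_pdivrMl// l2h//= (h_norm_le (nT h) Sv).
  split=> [u v _ _|a u v w _ _ _|u [Su _] u0].
  + exact: h_innerC.
  + exact: h_inner_linear.
  + rewrite lt_neqAle h_inner_ge0// andbT eq_sym; apply/eqP => uu.
    exact/u0/(h_inner_eq0 (nT h) Su).
(* The passage goes from the L^2 norm of the interpolant to its discrete norm, then by contraction
   to the discrete norm of tau, then back to L^2; the two changes of norm give the two factors. *)
- exists (Num.sqrt (K + 1) * Num.sqrt (9 ^+ n)) => h; split.
  + by move=> u t0; exact: l2_h_inner_const.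
  + by move=> u; exact: interpolant_unique.
  + move=> u w hu wu; split.
    * exact: interpolant_dmesh wu.
    * have [Qw _] := (is_interpolantP (nT h) w hu).1 wu.
      apply: (le_trans (l2h h w (fun T => Q1m_S1p (Qw T)))).
      rewrite -mulrA; apply: ler_wpM2l; first exact: ltW.
      exact: le_trans (interpolant_h_norm (nT h) hu wu) (h_norm_le (nT h) hu.1).
    * by move=> t0; exact: interpolant_h_inner wu.
- move=> h; split=> [u _|u u' w w' _ _ hw hw' x uu' T s].
    exact: coderivative_unique.
  exact: (coderivative_local (nT h) hw hw' uu').
Qed.
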